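(* Let $H\in(\frac12,1)$, let $I\subset\mathbb{N}$ be finite, and let $\Phi_t$ be the flow on $\mathbb{R}^n$ defined by $$\Phi_t(x)=x+\sum_{\gamma\in I}\int_0^t U_\gamma(\Phi_s(x))\,dB^H_\gamma(s),\qquad x\in\mathbb{R}^n,\ t\ge0,$$ where $\{B^H_\gamma\}_{\gamma\in\mathbb{N}}$ are independent fractional Brownian motions with Hurst parameter $H$ and $\{U_\gamma\}_{\gamma\in\mathbb{N}}$ are deterministic vector fields on $\mathbb{R}^n$ satisfying the regularity assumptions (A1)–(A4) listed in the context, with constants $M_\gamma,M^{(1)}_\gamma,M^{(2)}_\gamma$. Let $M$ be an $m$-dimensional $C^2$ manifold embedded in $\mathbb{R}^n$, $m<n$, and let $M_t=\Phi_t(M)$. Let $\alpha=1-H+\delta$ and $\beta=H-\varepsilon$ with $\varepsilon>0$, $1-H<\alpha<\frac12$ and $\delta>\varepsilon$. Then there exist a (deterministic) constant $c_1$ and, for every $T>0$, a random variable $C_{1,T}$ such that, almost surely, $$\sup_{t\in[0,T]}\mathcal{H}_m(M_t)\;\le\;c_1\,\mathcal{H}_m(M)\;2^{\,C_{1,T}\,T}.$$ Here $C_{1,T}$ depends on $\alpha$, $\beta$, $n$, $I$ and $\{\|B^H_\gamma\|_{\beta,T},M_\gamma,M^{(1)}_\gamma,M^{(2)}_\gamma\}_{\gamma\in I}$, and satisfies $$E\big[(C_{1,T})^{\beta}\big]\le C_1\cdot E\big[\|B^H\|_{\beta,T}\big],$$ where $B^H$ denotes a generic fractional Brownian motion with Hurst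 parameter $H$ and the constant $C_1$ depends only on $\alpha$, $\beta$, $n$, $|I|$ and $\{M_\gamma,M^{(1)}_\gamma,M^{(2)}_\gamma\}_{\gamma\in I}$.
   Context: A fractional Brownian motion with Hurst parameter $H$ is the zero mean Gaussian process $\{B^H(t),t\ge0\}$ (taken with continuous sample paths) with covariance $E[B^H(s)B^H(t)]=\frac12(t^{2H}+s^{2H}-|t-s|^{2H})$. Assumptions on the vector fields: there are constants $M_\gamma,M^{(1)}_\gamma,M^{(2)}_\gamma$, $\gamma\in\mathbb{N}$, such that for all $x,y\in\mathbb{R}^n$, all $\gamma\in\mathbb{N}$ and all $i,j$: (A1) $|U^i_\gamma(x)|\le M_\gamma$, where $U^i_\gamma$ is the $i$-th component of $U_\gamma$; (A2) $|U^i_\gamma(x)-U^i_\gamma(y)|\le M^{(1)}_\gamma\|x-y\|_2$; (A3) $|W^i_{\gamma,j}(x)-W^i_{\gamma,j}(y)|\le M^{(2)}_\gamma\|x-y\|_2$, where $W_\gamma=(W^i_{\gamma,j})_{i,j}$ is the matrix of spatial derivatives of $U_\gamma$; (A4) $\sum_{\gamma\in\mathbb{N}}M_\gamma<\infty$, $\sum_{\gamma\in\mathbb{N}}M^{(1)}_\gamma<\infty$, $\sum_{\gamma\in\mathbb{N}}M^{(2)}_\gamma<\infty$. $\|\cdot\|_2$ is the Euclidean norm. For a function $f$ on $[0,T]$ and $\lambda\in(0,1]$, $\|f\|_{\lambda,T}=\sup_{0\le c<d\le T}\frac{\|f(d)-f(c)\|_2}{|d-c|^{\lambda}}$. The stochastic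 integral is the pathwise generalized Stieltjes integral of Zähle; for a $\lambda$-Hölder integrand and a $\mu$-Hölder integrator with $\lambda+\mu>1$ (as is the case here) it coincides with the Riemann–Stieltjes integral. For each $x$ the flow equation has a unique solution $t\mapsto\Phi_t(x)$ in the space of $(1-\alpha)$-Hölder continuous functions on $[0,T]$. $\mathcal{H}_m$ denotes $m$-dimensional Hausdorff measure. *)

(* Defs.v *)
From HB Require Import structures.
From mathcomp Require Import all_boot all_order all_algebra.
From mathcomp Require Import finmap.
From mathcomp Require Import all_classical all_reals all_analysis.

Set Implicit Arguments.
Unset Strict Implicit.
Unset Printing Implicit Defensive.

Import Order.TTheory GRing.Theory Num.Theory.
Import numFieldNormedType.Exports.

Local Open Scope classical_set_scope.
Local Open Scope ring_scope.

(* The library's norm on ['rV_n] is the sup norm, hence an explicit Euclidean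
   norm. Both induce the same topology and the same notion of derivative. *)
Definition norm2 (R : realType) (n : nat) (x : 'rV[R]_n) : R :=
  Num.sqrt (\sum_(i < n) x ord0 i ^+ 2).

(* [N] is the norm on the target: [Num.norm] for real paths, [norm2] for paths
   in R^n. The value is +oo when the path is not [lambda]-Hoelder. *)
Definition holder_seminorm (R : realType) (V : zmodType) (N : V -> R)
    (lambda T : R) (f : R -> V) : \bar R :=
  ereal_sup [set r | exists c d : R, [/\ 0 <= c, c < d, d <= T &
    r = (N (f d - f c) / (`|d - c| `^ lambda))%:E]].

Section Processes.
Context (R : realType) (d : measure_display) (Omega : measurableType d)
  (P : probability Omega R).

(* Zero variance is a separate case: [normal_prob mu 0] is not [\d_mu]. *)
Definition gaussian_rv (X : Omega -> R) : Prop :=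
  measurable_fun setT X /\
  exists mu sigma : R, forall A : set R, measurable A ->
    P (X @^-1` A) = if sigma == 0 then \d_mu A else normal_prob mu sigma A.

(* A process is a function of time and outcome; only times [t >= 0] matter. *)
Definition gaussian_process (X : R -> Omega -> R) : Prop :=
  forall (k : nat) (t a : 'I_k -> R), (forall i, 0 <= t i) ->
    gaussian_rv (fun w => \sum_(i < k) a i * X (t i) w).

Definition fBm (H : R) (B : R -> Omega -> R) : Prop :=
  [/\ gaussian_process B,
      forall t, 0 <= t -> ('E_P[B t] = 0)%E,
      forall s t, 0 <= s -> 0 <= t ->
        ('E_P[fun w => (B s w * B t w)%R] =
        (2^-1 * (t `^ (2 * H) + s `^ (2 * H) - `|t - s| `^ (2 * H)))%R%:E)%E &
      forall w, {within `[0, +oo[, continuous (fun t => B t w)}].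

Definition sigma_process (X : R -> Omega -> R) : set (set Omega) :=
  <<s [set A | exists t (S : set R),
         [/\ 0 <= t, measurable S & A = X t @^-1` S]] >>.

Definition independent_processes (B : nat -> R -> Omega -> R) : Prop :=
  forall (J : {fset nat}) (A : nat -> set Omega),
    (forall j, j \in J -> sigma_process (B j) (A j)) ->
    P (\bigcap_(j in [set` J]) A j) = (\prod_(j <- J) P (A j))%E.

End Processes.

(* The limit is over all tagged partitions as the mesh tends to 0. For Hoelder
   [f] and [g] with exponents of sum > 1 this is the value of the generalized
   Stieltjes integral of f against g. *)
Definition is_RS_integral (R : realType) (f g : R -> R) (a b v : R) : Prop :=
  forall e : R, 0 < e -> exists2 eta : R, 0 < eta &
    forall (N : nat) (p xi : nat -> R),
      p 0%N = a -> p N = b ->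
      (forall k, (k < N)%N ->
        [/\ p k <= xi k, xi k <= p k.+1 & p k.+1 - p k < eta]) ->
      `|\sum_(k < N) f (xi k) * (g (p k.+1) - g (p k)) - v| < e.

(* [phi] is a [lambda]-Hoelder solution, started at [x], of
   phi_t = x + sum_(gamma in I) int_0^t U_gamma(phi_s) dg_gamma(s).
   The integrals are taken componentwise, with values [J gamma]. *)
Definition solves_flow_eq (R : realType) (n : nat) (I : {fset nat})
    (U : nat -> 'rV[R]_n -> 'rV[R]_n) (g : nat -> R -> R) (lambda : R)
    (x : 'rV[R]_n) (phi : R -> 'rV[R]_n) : Prop :=
  (forall T, 0 < T -> (holder_seminorm (@norm2 R n) lambda T phi < +oo)%E) /\
  forall t, 0 <= t -> exists J : nat -> 'rV[R]_n,
    (forall gamma i, gamma \in I ->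
      is_RS_integral (fun s => U gamma (phi s) ord0 i) (g gamma) 0 t
        (J gamma ord0 i)) /\
    phi t = x + \sum_(gamma <- I) J gamma.

(* Row vectors are multiplied on the right, so ['J f x j i] is the derivative of
   the [i]-th component of [f] in direction [j]. *)
Definition regular_fields (R : realType) (n : nat)
    (U : nat -> 'rV[R]_n -> 'rV[R]_n) (M M1 M2 : nat -> R) : Prop :=
  [/\ forall gamma x, differentiable (U gamma) x,
      forall gamma x i, `|U gamma x ord0 i| <= M gamma,
      forall gamma x y i,
        `|U gamma x ord0 i - U gamma y ord0 i| <= M1 gamma * norm2 (x - y),
      forall gamma x y i j,
        `|('J (U gamma) x) j i - ('J (U gamma) y) j i|
          <= M2 gamma * norm2 (x - y) &
      [/\ (\sum_(0 <= gamma <oo) (M gamma)%:E < +oo)%E,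
          (\sum_(0 <= gamma <oo) (M1 gamma)%:E < +oo)%E &
          (\sum_(0 <= gamma <oo) (M2 gamma)%:E < +oo)%E]].

(* Meaningful for [A] open: all partial derivatives of order at most [k] exist
   and are continuous on [A]. *)
Fixpoint Ck_on (R : realType) (n k : nat) (A : set 'rV[R]_n)
    (f : 'rV[R]_n -> R) : Prop :=
  {in A, continuous f} /\
  if k is k'.+1 then
    forall j : 'I_n, {in A, forall x, derivable f x (delta_mx ord0 j)} /\
      Ck_on k' A (fun x => 'D_(delta_mx ord0 j) f x)
  else True.

Definition C2_map_on (R : realType) (n : nat) (A : set 'rV[R]_n)
    (f : 'rV[R]_n -> 'rV[R]_n) : Prop :=
  forall i : 'I_n, Ck_on 2 A (fun x => f x ord0 i).

(* Embedded submanifold via slice charts: near each point a C^2 diffeomorphism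
   [phi : A -> B] with inverse [psi] carries [M] onto R^m x {0}. *)
Definition embedded_C2_manifold (R : realType) (m n : nat)
    (M : set 'rV[R]_n) : Prop :=
  forall p, M p ->
  exists (A B : set 'rV[R]_n) (phi psi : 'rV[R]_n -> 'rV[R]_n),
    [/\ open A /\ open B, A p,
        (forall x, A x -> B (phi x) /\ psi (phi x) = x) /\
        (forall y, B y -> A (psi y) /\ phi (psi y) = y),
        C2_map_on A phi /\ C2_map_on B psi &
        forall x, A x ->
          (M x <-> forall j : 'I_n, (m <= j)%N -> phi x ord0 j = 0)].

Section Hausdorff.
Context (R : realType) (n : nat).
Implicit Types E A : set 'rV[R]_n.

(* This is -oo for the empty set. *)
Definition diam2 E : \bar R :=
  ereal_sup [set r | exists x y, [/\ E x, E y & r = (norm2 (x - y))%:E]].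

(* The empty set has size 0 and, for [m = 0], a nonempty set has size 1. *)
Definition diam_pow (m : nat) E : \bar R :=
  if `[< E = set0 >] then 0%E else (diam2 E ^+ m)%E.

Definition hausdorff_pre (m : nat) (delta : R) A : \bar R :=
  ereal_inf [set r | exists E : nat -> set 'rV[R]_n,
    [/\ A `<=` \bigcup_k E k, forall k, (diam2 (E k) <= delta%:E)%E &
        r = (\sum_(0 <= k <oo) diam_pow m (E k))%E]].

(* Limit as [delta] tends to 0. No normalising factor depending on [m]. *)
Definition hausdorff (m : nat) A : \bar R :=
  ereal_sup [set hausdorff_pre m delta A | delta in [set delta | 0 < delta]].

End Hausdorff.

(* Main.v *)
Require Import Defs.
From HB Require Import structures.
From mathcomp Require Import all_boot all_order all_algebra.
From mathcomp Require Import finmap multiset.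
From mathcomp Require Import ring lra.
From mathcomp Require Import all_classical all_reals all_analysis.
From mathcomp Require Import measurable_realfun.

Set Implicit Arguments.
Unset Strict Implicit.
Unset Printing Implicit Defensive.

Import Order.TTheory GRing.Theory Num.Theory.
Import numFieldNormedType.Exports.

Local Open Scope classical_set_scope.
Local Open Scope ring_scope.

(* A map with Lipschitz constant [L] multiplies m-dimensional Hausdorff measure
   by at most [L ^+ m], so everything rests on the Lipschitz constant of [Phi t].

   Lipschitz bound. By the Young-Loeve estimate and the second difference of
   the vector fields, two solutions move apart by a factor at most 2 on a time
   interval of length [D] as soon as [Q * D `^ beta <= 1], where [Q] is a
   constant times the sum of the Hoelder seminorms of the driving paths.
   Cutting [0, T] into about [T * Q `^ beta^-1] such intervals gives the factor
   [2 `^ (T * Q `^ beta^-1)], whose exponent is linear in the seminorms after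
   raising to the power [beta].

   Expectation. The Hoelder seminorm is finite almost surely by a
   Kolmogorov-Chentsov argument on dyadic points. Its expectation is that of
   any other fractional Brownian motion with the same [H]: linear combinations
   of the process are centered normal with variance given by the covariance,
   hence so are their cosine transforms, and products of polynomials in these
   cosines converge to indicators of orthants, so that the finite-dimensional
   laws agree. *)

(** * The Young-Loeve estimate *)

(** Lipschitz fields alone are not enough: to integrate [U (phi) - U (psi)] against a rough path,
    this difference must be Hoelder with a constant proportional to the distance of the two
    solutions, and that comes from the Lipschitz Jacobian through second differences. Hoelder
    constants are measured relative to the length [D] of the interval, so that the roughness enters
    through the single product of [S] and [D^beta]; the a priori finite Hoelder constant of a
    solution starts an iteration that forgets it. The estimates use the sup norm; the Euclidean norm
    returns only at the end, at the price of a factor [n] in [c1].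

    The expectation is bounded by that of a generic process, which may live on another probability
    space. Only equality of laws links the two, and the seminorm is a supremum over uncountably many
    pairs. Continuity of paths reduces it to dyadic pairs, and its distribution function to
    decreasing limits of probabilities of finitely many linear inequalities; this is why joint laws
    are compared on orthants only. *)

Section Young.
Variable R : realType.
Implicit Types (f g : R -> R) (a b : R).

(** With tags at left endpoints, the sum over a single interval is the term [f a * (g b - g a)]
    around which the Young estimate is centered. *)
Definition left_sum f g a b (mesh S : R) : Prop :=
  exists (N : nat) (p : nat -> R), [/\ p 0%N = a, p N = b,
    forall k, (k < N)%N -> p k <= p k.+1 /\ p k.+1 - p k < mesh &
    S = \sum_(k < N) f (p k) * (g (p k.+1) - g (p k))].

Lemma left_sum_cat f g a m b mesh S1 S2 :
  left_sum f g a m mesh S1 -> left_sum f g m b mesh S2 ->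
  left_sum f g a b mesh (S1 + S2).
Proof.
move=> [N1 [p1 [p1a p1m H1 ->]]] [N2 [p2 [p2m p2b H2 ->]]].
pose p k := if (k <= N1)%N then p1 k else p2 (k - N1)%N.
have pl k : (k <= N1)%N -> p k = p1 k by rewrite /p => ->.
have pr k : p (N1 + k)%N = p2 k.
  rewrite /p; case: ifP => [|_]; last by rewrite addKn.
  by case: k => [|k]; rewrite ?addn0 ?p1m ?p2m// -{2}(addn0 N1) leq_add2l.
exists (N1 + N2)%N, p; split.
- by rewrite pl.
- by rewrite pr.
- move=> k kN; have [kN1|kN1] := ltnP k N1.
    by rewrite !pl//; [exact: H1|exact: ltnW].
  rewrite -(subnKC kN1) -addnS !pr; apply: H2.
  by rewrite -(ltn_add2l N1) subnKC.
- rewrite big_split_ord /=; congr (_ + _); apply: eq_bigr => k _.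
    by rewrite !pl// ltnW.
  by rewrite -addnS !pr.
Qed.

Lemma is_RS_integral_left_sum f g a b v : is_RS_integral f g a b v ->
  forall e, 0 < e -> exists2 mesh, 0 < mesh &
    forall S, left_sum f g a b mesh S -> `|S - v| < e.
Proof.
move=> fgv e e0; have [mesh mesh0 H] := fgv _ e0; exists mesh => // S.
move=> [N [p [pa pb Hp ->]]]; apply: H => // k /Hp[pk pm]; split => //.
Qed.

(** Defined by repeated bisection, so that the Young estimate becomes an induction on [n]. *)
Fixpoint dyadic_sum f g (n : nat) a b : R :=
  if n is n'.+1 then
    dyadic_sum f g n' a ((a + b) / 2) + dyadic_sum f g n' ((a + b) / 2) b
  else f a * (g b - g a).

Lemma left_sum_dyadic f g n : forall a b mesh, a <= b ->
  (b - a) / 2 ^+ n < mesh -> left_sum f g a b mesh (dyadic_sum f g n a b).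
Proof.
elim: n => [|n IH] a b mesh ab; rewrite ?expr0 ?divr1 => abm /=.
  exists 1%N, (fun k => if k is 0%N then a else b); split => //.
    by case.
  by rewrite big_ord1.
have e : (b - a) / 2 / 2 ^+ n = (b - a) / 2 ^+ n.+1.
  by rewrite exprS invfM mulrA.
apply: (@left_sum_cat _ _ _ ((a + b) / 2)); apply: IH.
- lra.
- by have -> : (a + b) / 2 - a = (b - a) / 2; [field|rewrite e].
- lra.
- by have -> : b - (a + b) / 2 = (b - a) / 2; [field|rewrite e].
Qed.

Lemma left_sum_exists f g a b mesh : a <= b -> 0 < mesh ->
  exists n, left_sum f g a b mesh (dyadic_sum f g n a b).
Proof.
move=> ab m0.
have [n Hn] : exists n, (b - a) / 2 ^+ n < mesh.
  exists (Num.bound ((b - a) / mesh)).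
  rewrite ltr_pdivrMr ?exprn_gt0// mulrC -ltr_pdivrMr//.
  exact: upper_nthrootP.
by exists n; apply: left_sum_dyadic.
Qed.

(** The solution [K] of [2 * K + 1 = K * 2^theta]: the two halves of an interval each contribute [K]
    at half the scale, and the bisection itself contributes 1. *)
Definition young_const (theta : R) := (2 `^ theta - 2)^-1.

Lemma young_const_eq theta : 1 < theta ->
  (2 * young_const theta + 1) = young_const theta * 2 `^ theta
  /\ 0 < young_const theta.
Proof.
move=> th1; have : 2 < 2 `^ theta.
  rewrite -[ltLHS]powRr1// /powR (_ : (2 == 0 :> R) = false) ?pnatr_eq0//.
  by rewrite ltr_expR ltr_pM2r// ln_gt0// ltr1n.
move=> h; rewrite /young_const; split; last by rewrite invr_gt0 subr_gt0.
by field; rewrite subr_eq0 gt_eqF.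
Qed.

(** Bisecting at [m] creates the single new term [(f m - f a) * (g b - g m)], of order [lam + beta]
    in the half length. Since this exponent exceeds 1, the errors of the two halves leave room for
    it. Bisections are enough because the integrals to which the bound is applied are given, not
    constructed. *)
Lemma dyadic_sum_bound f g (lam beta F G D : R) s t : 0 < D ->
  1 < lam + beta -> 0 < lam -> 0 < beta -> 0 <= F -> 0 <= G ->
  (forall x y, s <= x -> x <= y -> y <= t ->
     `|f y - f x| <= F * ((y - x) / D) `^ lam) ->
  (forall x y, s <= x -> x <= y -> y <= t ->
     `|g y - g x| <= G * ((y - x) / D) `^ beta) ->
  forall n a b, s <= a -> a <= b -> b <= t ->
  `|dyadic_sum f g n a b - f a * (g b - g a)| <=
    young_const (lam + beta) * F * G * ((b - a) / D) `^ (lam + beta).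
Proof.
move=> D0 th1 lam0 beta0 F0 G0 Hf Hg; have [Keq K0] := young_const_eq th1.
elim=> [|n IH] a b sa ab bt /=.
  by rewrite subrr normr0 !mulr_ge0// ?powR_ge0// ltW.
set m := (a + b) / 2.
have am : a <= m by rewrite /m; lra.
have mb : m <= b by rewrite /m; lra.
have Hl := IH a m sa am (le_trans mb bt).
have Hr := IH m b (le_trans sa am) mb bt.
have Hfm := Hf a m sa am (le_trans mb bt).
have Hgm := Hg m b (le_trans sa am) mb bt.
have e1 : (m - a) / D = (b - a) / D / 2 by rewrite /m; field; rewrite gt_eqF.
have e2 : (b - m) / D = (b - a) / D / 2 by rewrite /m; field; rewrite gt_eqF.
rewrite e1 in Hl Hfm; rewrite e2 in Hr Hgm.
set r := (b - a) / D in Hl Hr Hfm Hgm *.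
have r0 : 0 <= r by rewrite divr_ge0 ?subr_ge0// ltW.
have rth : r `^ (lam + beta) = (r / 2) `^ (lam + beta) * 2 `^ (lam + beta).
  have r20 : 0 <= r / 2 by rewrite divr_ge0.
  by rewrite -(@powRM _ _ _ _ r20)// divfK.
rewrite rth.
have Hm : `|(f m - f a) * (g b - g m)| <= F * G * (r / 2) `^ (lam + beta).
  rewrite normrM (le_trans (ler_pM _ _ Hfm Hgm))//.
  rewrite powRD; last by rewrite gt_eqF// ltr_wpDl ?ltW.
  by rewrite le_eqVlt; apply/orP; left; apply/eqP; ring.
set Kc := young_const _ in Keq K0 Hl Hr *.
set q := (r / 2) `^ (lam + beta) in Hl Hr Hm *.
have -> : Kc * F * G * (q * 2 `^ (lam + beta)) =
  Kc * F * G * q + Kc * F * G * q + F * G * q.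
  transitivity (F * G * q * (Kc * 2 `^ (lam + beta))); first by ring.
  by rewrite -Keq; ring.
have -> : dyadic_sum f g n a m + dyadic_sum f g n m b - f a * (g b - g a) =
  (dyadic_sum f g n a m - f a * (g m - g a)) +
  (dyadic_sum f g n m b - f m * (g b - g m)) + (f m - f a) * (g b - g m).
  by ring.
by rewrite (le_trans (ler_normD _ _))// lerD// (le_trans (ler_normD _ _))// lerD.
Qed.

(* [D] is a length scale. *)
Lemma young_loeve f g (lam beta F G D : R) s t u v : 0 < D ->
  1 < lam + beta -> 0 < lam -> 0 < beta -> 0 <= F -> 0 <= G ->
  0 <= s -> s <= t ->
  (forall x y, s <= x -> x <= y -> y <= t ->
     `|f y - f x| <= F * ((y - x) / D) `^ lam) ->
  (forall x y, s <= x -> x <= y -> y <= t ->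
     `|g y - g x| <= G * ((y - x) / D) `^ beta) ->
  is_RS_integral f g 0 s u -> is_RS_integral f g 0 t v ->
  `|v - u - f s * (g t - g s)| <=
    young_const (lam + beta) * F * G * ((t - s) / D) `^ (lam + beta).
Proof.
move=> D0 th1 lam0 beta0 F0 G0 s0 st Hf Hg Iu Iv.
apply/ler_addgt0Pr => e e0.
have e20 : 0 < e / 2 by lra.
have [m1 m10 H1] := is_RS_integral_left_sum Iu e20.
have [m2 m20 H2] := is_RS_integral_left_sum Iv e20.
(* A sum over [[0, s]] that is fine enough for [u], continued by one over [[s, t]], is fine enough
   for [v]. The second piece thus approximates [v - u], without any integral that starts at [s]. *)
set mm := Num.min m1 m2.
have mm0 : 0 < mm by rewrite lt_min m10.
have mesh_le mesh mesh' a b S : mesh <= mesh' -> left_sum f g a b mesh S ->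
    left_sum f g a b mesh' S.
  move=> mm' [N [p [pa pb pp ->]]]; exists N, p; split => // k /pp[? ?].
  by split => //; lra.
have [n1 S1] := left_sum_exists f g s0 mm0.
have [n2 S2] := left_sum_exists f g st mm0.
have {}H1 := H1 _ (mesh_le _ _ _ _ _ (ltac:(by rewrite ge_min lexx) : mm <= m1) S1).
have {}H2 := H2 _ (mesh_le _ _ _ _ _ (ltac:(by rewrite ge_min lexx orbT) : mm <= m2) (left_sum_cat S1 S2)).
have H3 := dyadic_sum_bound D0 th1 lam0 beta0 F0 G0 Hf Hg n2 (lexx s) st (lexx t).
set A := dyadic_sum _ _ _ _ _ in H1 H2.
set B := dyadic_sum _ _ _ _ _ in H2 H3.
have -> : v - u - f s * (g t - g s) =
  (B - f s * (g t - g s)) + ((A - u) - (A + B - v)) by ring.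
rewrite (le_trans (ler_normD _ _))// lerD//.
rewrite (le_trans (ler_normB _ _))//.
by rewrite [leRHS](splitr e) lerD// ltW.
Qed.

End Young.

(** * Second differences of the vector fields *)

Section Norms.
Variables (R : realType) (n : nat).
Implicit Types x : 'rV[R]_n.

Lemma ler_coord_norm x (i : 'I_n) : `|x ord0 i| <= `|x|.
Proof.
by rewrite [leRHS]/Num.Def.normr/= mx_normrE (@le_bigmax _ _ _ _ (fun ij => `|x ij.1 ij.2|) (ord0, i)).
Qed.

Lemma ler_norm_coord x (e : R) : 0 <= e ->
  (forall i : 'I_n, `|x ord0 i| <= e) -> `|x| <= e.
Proof.
move=> e0 H; rewrite [leLHS]/Num.Def.normr/= mx_normrE; apply: bigmax_le => // -[i j] _ /=.
by rewrite (ord1 i).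
Qed.

Lemma ler_norm_norm2 x : `|x| <= norm2 x.
Proof.
apply: ler_norm_coord; first exact: sqrtr_ge0.
move=> i; rewrite -sqrtr_sqr ler_wsqrtr// (bigD1 i)//= lerDl sumr_ge0// => j _.
exact: sqr_ge0.
Qed.

Lemma ler_norm2_norm x : norm2 x <= n%:R * `|x|.
Proof.
rewrite -[leRHS]ger0_norm ?mulr_ge0// -sqrtr_sqr ler_wsqrtr//.
apply: (@le_trans _ _ (\sum_(i < n) `|x| ^+ 2)).
  apply: ler_sum => i _; rewrite -[leLHS]real_normK ?num_real//.
  by rewrite lerXn2r ?nnegrE// ler_coord_norm.
rewrite sumr_const card_ord -[leLHS]mulr_natl exprMn ler_wpM2r ?sqr_ge0//.
rewrite -natrX ler_nat -mulnn; case: (n) => // k; exact: leq_pmulr.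
Qed.

End Norms.

Section Fields.
Variables (R : realType) (n : nat) (U : 'rV[R]_n -> 'rV[R]_n).
Hypothesis dU : forall x, differentiable U x.

Lemma is_derive_along (p v : 'rV[R]_n) (i : 'I_n) (th : R) :
  is_derive th 1 (fun s : R => U (p + s *: v) ord0 i)
    ((v *m 'J U (p + th *: v)) ord0 i).
Proof.
pose M (s : R) := U (p + s *: v).
have E : (fun h : R => h^-1 *: ((M \o shift th) (h *: 1) - M th)) =
  (fun h : R => h^-1 *: ((U \o shift (p + th *: v)) (h *: v) - U (p + th *: v))).
  apply/funext => h; rewrite /M /=; congr (_ *: (U _ - _)).
  by rewrite scalerDl /= addrCA -[in RHS](mulr1 h).
have dM : derivable M th 1.
  by rewrite /derivable E; apply: (@diff_derivable _ _ _ U (p + th *: v) v (dU _)).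
have DM : 'D_1 M th = v *m 'J U (p + th *: v).
  by rewrite -(deriveEjacobian v (dU _)) /derive E.
apply: DeriveDef; first exact: (derivable_mxP M th 1).1 dM ord0 i.
by rewrite -DM derive_mx// mxE.
Qed.

(** Mean value theorem along [v] for the difference of the two translates: its derivative pairs [v]
    with a difference of Jacobians at points that always differ by [p - q]. One factor [n] comes
    from the sum over coordinates, the other from bounding [norm2] by the sup norm. *)
Lemma second_difference_le (M2 : R) (i : 'I_n) (p q v : 'rV[R]_n) :
  0 <= M2 ->
  (forall x y j, `|('J U x) j i - ('J U y) j i| <= M2 * norm2 (x - y)) ->
  `|(U (p + v) ord0 i - U p ord0 i) - (U (q + v) ord0 i - U q ord0 i)| <=
    n%:R ^+ 2 * M2 * `|v| * `|p - q|.
Proof.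
move=> M20 HJ.
pose f (s : R) := U (p + s *: v) ord0 i - U (q + s *: v) ord0 i.
pose df (s : R) := (v *m 'J U (p + s *: v)) ord0 i - (v *m 'J U (q + s *: v)) ord0 i.
have fdf (s : R) : is_derive s (1:R) f (df s).
  by apply: is_deriveB; exact: is_derive_along.
have [|c _] := @MVT R f df 0 1 ltr01 (fun s _ => fdf s).
  by apply: derivable_within_continuous => s _; have [] := fdf s.
rewrite subr0 mulr1 /f !scale1r !scale0r !addr0 => e.
have -> : U (p + v) ord0 i - U p ord0 i - (U (q + v) ord0 i - U q ord0 i) = df c.
  by rewrite -e; ring.
have mE (A : 'M[R]_n) : (v *m A) ord0 i = \sum_j v ord0 j * A j i by rewrite mxE.
have HJi := HJ (p + c *: v) (q + c *: v).
rewrite /df; move: ('J U (p + c *: v)) ('J U (q + c *: v)) HJi => J1 J2 HJi.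
rewrite (mE J1) (mE J2) -sumrB.
apply: (@le_trans _ _ (\sum_(j < n) `|v| * (M2 * (n%:R * `|p - q|)))).
  apply: (le_trans (ler_norm_sum _ _ _)); apply: ler_sum => j _.
  rewrite -mulrBr normrM ler_pM// ?ler_coord_norm//.
  apply: (le_trans (HJi _)); rewrite ler_wpM2l//.
  have -> : p + c *: v - (q + c *: v) = p - q by rewrite opprD addrACA subrr addr0.
  exact: ler_norm2_norm.
rewrite sumr_const card_ord -[leLHS]mulr_natl le_eqVlt; apply/orP; left.
by apply/eqP; ring.
Qed.
End Fields.

(** * Flow increments *)

Section Increments.
Variable R : realType.

Lemma powR_le_exp (x p q : R) : 0 <= x <= 1 -> 0 < p -> p <= q -> x `^ q <= x `^ p.
Proof.
move=> /andP[x0 x1] p0 pq; move: x0; rewrite le_eqVlt => /predU1P[<-|x0].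
  by rewrite !powR0// gt_eqF// (lt_le_trans p0).
by apply: ger_powR => //; rewrite x0.
Qed.

Lemma powR_le1 (x p : R) : 0 <= x <= 1 -> 0 <= p -> x `^ p <= 1.
Proof.
move=> /andP[x0 x1] p0; have <- : (1 : R) `^ p = 1 by rewrite powR1.
by apply: ge0_ler_powR; rewrite ?nnegrE.
Qed.

Lemma is_RS_integralB (f1 f2 g : R -> R) a b v1 v2 :
  is_RS_integral f1 g a b v1 -> is_RS_integral f2 g a b v2 ->
  is_RS_integral (fun s => f1 s - f2 s) g a b (v1 - v2).
Proof.
move=> H1 H2 e e0; have e20 : 0 < e / 2 by lra.
have [m1 m10 {}H1] := H1 _ e20; have [m2 m20 {}H2] := H2 _ e20.
exists (Num.min m1 m2); first by rewrite lt_min m10.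
move=> N p xi pa pb H.
have {}H1 : `|\sum_(k < N) f1 (xi k) * (g (p k.+1) - g (p k)) - v1| < e / 2.
  by apply: H1 => // k /H[-> ->]; rewrite lt_min => /andP[->].
have {}H2 : `|\sum_(k < N) f2 (xi k) * (g (p k.+1) - g (p k)) - v2| < e / 2.
  by apply: H2 => // k /H[-> ->]; rewrite lt_min => /andP[_ ->].
under eq_bigr do rewrite mulrBl.
rewrite sumrB; set A := (X in X - v1) in H1 *; set B := (X in X - v2) in H2 *.
have -> : A - B - (v1 - v2) = (A - v1) - (B - v2) by ring.
by rewrite (le_lt_trans (ler_normB _ _))// (splitr e) ltrD.
Qed.

(** The ratio [(d - c) / D] is at most 1, so the leading term, of order [beta], and the Young error,
    of order [lam + beta], are both absorbed into order [lam]. The result has the form of the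
    assumption on [f], so it can be iterated, with [G * D^beta] as the small factor. *)
Lemma RS_increment_le (f g : R -> R) (lam beta a F G D c d u v : R) : 0 < D ->
  1 < lam + beta -> 0 < lam -> lam <= beta -> 0 <= a -> 0 <= F -> 0 <= G ->
  0 <= c -> c <= d -> d - c <= D ->
  `|f c| <= a ->
  (forall x y, c <= x -> x <= y -> y <= d ->
     `|f y - f x| <= F * ((y - x) / D) `^ lam) ->
  (forall x y, c <= x -> x <= y -> y <= d -> `|g y - g x| <= G * (y - x) `^ beta) ->
  is_RS_integral f g 0 c u -> is_RS_integral f g 0 d v ->
  `|v - u| <= G * D `^ beta * (a + young_const (lam + beta) * F) * ((d - c) / D) `^ lam.
Proof.
move=> D0 th1 lam0 lb a0 F0 G0 c0 cd cdD fc Hf Hg Iu Iv.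
have beta0 := lt_le_trans lam0 lb.
have GD0 : 0 <= G * D `^ beta by rewrite mulr_ge0// powR_ge0.
have Hg' x y : c <= x -> x <= y -> y <= d ->
    `|g y - g x| <= G * D `^ beta * ((y - x) / D) `^ beta.
  move=> cx xy yd; rewrite -mulrA -powRM ?divr_ge0 ?subr_ge0 ?(ltW D0)//.
  by rewrite (mulrC D) divfK ?gt_eqF//; exact: Hg.
have H := young_loeve D0 th1 lam0 beta0 F0 GD0 c0 cd Hf Hg' Iu Iv.
have [_ K0] := young_const_eq th1.
set K := young_const _ in H K0 *.
set r := (d - c) / D in H *.
have r01 : 0 <= r <= 1.
  by rewrite divr_ge0 ?subr_ge0 ?(ltW D0)//= ler_pdivrMr// mul1r.
have H1 := powR_le_exp r01 lam0 lb.
have H2 : r `^ (lam + beta) <= r `^ lam by apply: powR_le_exp => //; rewrite lerDl ltW.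
have -> : v - u = (v - u - f c * (g d - g c)) + f c * (g d - g c) by ring.
have Hgd := Hg' c d (lexx c) cd (lexx d).
move: GD0 H Hgd; set GD := G * D `^ beta => GD0 H Hgd.
rewrite -/r in Hgd.
apply: (le_trans (ler_normD _ _)).
have -> : GD * (a + K * F) * r `^ lam = K * F * GD * r `^ lam + a * (GD * r `^ lam).
  by ring.
apply: lerD.
  have KFG : 0 <= K * F * GD by rewrite mulr_ge0// mulr_ge0// ltW.
  by apply: (le_trans H); apply: ler_wpM2l.
rewrite normrM; apply: ler_pM => //; apply: (le_trans Hgd).
exact: ler_wpM2l.
Qed.

(** The map [Y |-> q + Y / 2] contracts to [2 * q]. Iterating it from any valid constant replaces
    the usual absorption of the best Hoelder constant, and asks for no closure of [P] under
    limits. *)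
Lemma halving (P : R -> Prop) (q Y0 : R) : 0 <= q -> 0 <= Y0 -> P Y0 ->
  (forall Y, 0 <= Y -> P Y -> P (q + Y / 2)) ->
  forall e, 0 < e -> exists Y, [/\ 0 <= Y, Y <= 2 * q + e & P Y].
Proof.
move=> q0 Y00 PY0 H e e0.
have Hk k : exists Y, [/\ 0 <= Y, Y <= 2 * q + Y0 / 2 ^+ k & P Y].
  elim: k => [|k [Y [Yge Yle PY]]].
    by exists Y0; split => //; rewrite expr0 divr1; lra.
  exists (q + Y / 2); split; [lra| |exact: H].
  have -> : Y0 / 2 ^+ k.+1 = (Y0 / 2 ^+ k) / 2 by rewrite exprS invfM mulrA mulrAC.
  lra.
have [Y [Yge Yle PY]] := Hk (Num.bound (Y0 / e)); exists Y; split => //.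
apply: (le_trans Yle); rewrite lerD2l ler_pdivrMr ?exprn_gt0// mulrC.
by rewrite -ler_pdivrMr// ltW// upper_nthrootP.
Qed.

Lemma holder_seminorm_le (V : zmodType) (N : V -> R) (lambda T : R) (f : R -> V) c d :
  (holder_seminorm N lambda T f < +oo)%E -> 0 <= c -> c < d -> d <= T ->
  N (f d - f c) <= fine (holder_seminorm N lambda T f) * (d - c) `^ lambda.
Proof.
move=> fin c0 cd dT.
have h : ((N (f d - f c) / (d - c) `^ lambda)%:E <= holder_seminorm N lambda T f)%E.
  by apply: ereal_sup_ubound; exists c, d; rewrite ger0_norm// subr_ge0 ltW.
have e : holder_seminorm N lambda T f \is a fin_num.
  by rewrite fin_numE (lt_eqF fin) andbT gt_eqF// (lt_le_trans _ h)// ltNyr.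
rewrite -(ler_pdivrMr _ _ (powR_gt0 _ _)) ?subr_gt0//.
by rewrite -lee_fin fineK.
Qed.

End Increments.

Section Flow.
Variables (R : realType) (n : nat) (I : {fset nat}) (U : nat -> 'rV[R]_n -> 'rV[R]_n).
Variables (g : nat -> R -> R) (lam beta T A : R) (h : nat -> R).
Hypotheses (lam0 : 0 < lam) (lam_beta : lam <= beta) (th1 : 1 < lam + beta).
Hypothesis A0 : 0 <= A.
Hypothesis U_le : forall k x i, k \in I -> `|U k x ord0 i| <= A.
Hypothesis U_lip : forall k x y i, k \in I ->
  `|U k x ord0 i - U k y ord0 i| <= A * `|x - y|.
Hypothesis U_diff2 : forall k p q v i, k \in I ->
  `|(U k (p + v) ord0 i - U k p ord0 i) - (U k (q + v) ord0 i - U k q ord0 i)| <=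
    A * `|v| * `|p - q|.
Hypothesis h0 : forall k, 0 <= h k.
Hypothesis g_holder : forall k x y, k \in I -> 0 <= x -> x <= y -> y <= T ->
  `|g k y - g k x| <= h k * (y - x) `^ beta.

Let K := young_const (lam + beta).
Let S := \sum_(k <- I) h k.

Let K0 : 0 < K. Proof. by have [] := young_const_eq th1. Qed.
Let S0 : 0 <= S. Proof. by rewrite sumr_ge0. Qed.

(** In the sup norm every coordinate obeys the same bound, so that no factor [n] appears, only the
    sum [S] over the driving paths. *)
Lemma sum_increment_le (f : nat -> 'I_n -> R -> R) (Jc Jd : nat -> 'rV[R]_n)
    (D a F c d : R) : 0 < D -> 0 <= a -> 0 <= F -> 0 <= c -> c <= d -> d <= T ->
  d - c <= D ->
  (forall k i, k \in I -> `|f k i c| <= a) ->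
  (forall k i x y, k \in I -> c <= x -> x <= y -> y <= d ->
     `|f k i y - f k i x| <= F * ((y - x) / D) `^ lam) ->
  (forall k i, k \in I -> is_RS_integral (f k i) (g k) 0 c (Jc k ord0 i)) ->
  (forall k i, k \in I -> is_RS_integral (f k i) (g k) 0 d (Jd k ord0 i)) ->
  `|\sum_(k <- I) (Jd k - Jc k)| <= S * D `^ beta * (a + K * F) * ((d - c) / D) `^ lam.
Proof.
move=> D0 a0 F0 c0 cd dT cdD fa fF Ic Id.
have aKF : 0 <= a + K * F by rewrite addr_ge0// mulr_ge0// ltW.
apply: ler_norm_coord => [|i]; first by rewrite !mulr_ge0 ?powR_ge0.
rewrite summxE (le_trans (ler_norm_sum _ _ _))//.
rewrite /S !mulr_suml big_seq [leRHS]big_seq; apply: ler_sum => k kI.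
rewrite !mxE; apply: (RS_increment_le D0 th1 lam0 lam_beta a0 F0 (h0 k) c0 cd cdD
  (fa k i kI) _ _ (Ic k i kI) (Id k i kI)).
- by move=> x y cx xy yd; exact: fF.
- move=> x y cx xy yd; apply: g_holder => //; first exact: le_trans cx.
  exact: le_trans dT.
Qed.

Lemma solution_increment x phi c d : solves_flow_eq I U g lam x phi ->
  0 <= c -> 0 <= d -> exists Jc Jd : nat -> 'rV[R]_n,
  [/\ forall k i, k \in I ->
        is_RS_integral (fun s => U k (phi s) ord0 i) (g k) 0 c (Jc k ord0 i),
      forall k i, k \in I ->
        is_RS_integral (fun s => U k (phi s) ord0 i) (g k) 0 d (Jd k ord0 i) &
      phi d - phi c = \sum_(k <- I) (Jd k - Jc k)].
Proof.
move=> [_ H] c0 d0; have [Jc [HJc ec]] := H c c0; have [Jd [HJd ed]] := H d d0.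
exists Jc, Jd; split => //.
by rewrite ec ed sumrB opprD addrACA subrr add0r.
Qed.

Variables (D s : R).
Hypotheses (D0 : 0 < D) (s0 : 0 <= s) (sDT : s + D <= T).
Hypothesis small : 4 * (1 + 2 * K) * A * (S * D `^ beta) <= 1.

Let scale01 c d : s <= c -> c <= d -> d <= s + D -> 0 <= (d - c) / D <= 1.
Proof.
move=> sc cd ds; rewrite divr_ge0 ?subr_ge0 ?(ltW D0)//= ler_pdivrMr// mul1r.
by lra.
Qed.

(** The constant depends on the solution and is used only as a starting value for [halving]. *)
Lemma solution_holder_scaled (N : 'rV[R]_n -> R) phi :
  (forall x, `|x| <= N x) ->
  (holder_seminorm N lam T phi < +oo)%E ->
  exists2 Y, 0 <= Y & forall c d, s <= c -> c <= d -> d <= s + D ->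
    `|phi d - phi c| <= Y * ((d - c) / D) `^ lam.
Proof.
move=> HN fin.
exists (`|fine (holder_seminorm N lam T phi)| * D `^ lam).
  by rewrite mulr_ge0// powR_ge0.
move=> c d sc cd dsD; rewrite -mulrA -powRM ?divr_ge0 ?subr_ge0 ?(ltW D0)//.
rewrite (mulrC D) divfK ?gt_eqF//.
move: cd; rewrite le_eqVlt => /predU1P[<-|cd].
  by rewrite !subrr normr0 mulr_ge0// powR_ge0.
apply: (le_trans (HN _)); apply: (le_trans (holder_seminorm_le fin _ cd _)) => //.
- exact: le_trans sc.
- exact: le_trans sDT.
- by rewrite ler_wpM2r ?powR_ge0// ler_norm.
Qed.

(** The constant 1 depends neither on the starting point nor on the a priori Hoelder constant of
    [psi]. This uniformity keeps the second differences in [flow_step] linear in the distance of the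
    solutions. *)
Lemma solution_local x psi : solves_flow_eq I U g lam x psi ->
  forall c d, s <= c -> c <= d -> d <= s + D ->
    `|psi d - psi c| <= ((d - c) / D) `^ lam.
Proof.
move=> Hpsi.
pose P (Y : R) := forall c d, s <= c -> c <= d -> d <= s + D ->
    `|psi d - psi c| <= Y * ((d - c) / D) `^ lam.
have [Y0 Y00 PY0] : exists2 Y, 0 <= Y & P Y.
  apply: (@solution_holder_scaled (@norm2 R n)); first exact: ler_norm_norm2.
  apply: Hpsi.1; apply: lt_le_trans sDT; exact: ltr_wpDl.
pose q := A * (S * D `^ beta).
have q0 : 0 <= q by rewrite !mulr_ge0 ?powR_ge0.
(* So [q <= 1 / 4] and [K * q <= 1 / 8]: the map [Y |-> q + K * q * Y] stays below that of
   [halving], and the outcome [2 * q + 1 / 2] is at most 1. *)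
have sm : 4 * q + 8 * (K * q) <= 1 by apply: le_trans small; rewrite /q; lra.
have Kq0 : 0 <= K * q by rewrite mulr_ge0// ltW.
have step Y : 0 <= Y -> P Y -> P (q + Y / 2).
  move=> Y_0 PY c d sc cd dsD.
  have c0 := le_trans s0 sc; have d0 := le_trans c0 cd.
  have [Jc [Jd [Hc Hd ->]]] := solution_increment Hpsi c0 d0.
  have AY0 : 0 <= A * Y by rewrite mulr_ge0.
  apply: (le_trans (sum_increment_le D0 A0 AY0 c0 cd _ _ _ _ Hc Hd)).
  - exact: le_trans sDT.
  - lra.
  - by move=> k i kI; exact: U_le.
  - move=> k i y z kI cy yz zd; apply: (le_trans (U_lip _ _ _ kI)).
    rewrite -mulrA ler_wpM2l//; apply: PY => //; first exact: le_trans cy.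
    exact: le_trans dsD.
  - apply: ler_wpM2r; first exact: powR_ge0.
    have -> : S * D `^ beta * (A + K * (A * Y)) = q + (K * q) * Y by rewrite /q; ring.
    by rewrite lerD2l mulrC ler_wpM2l//; lra.
have e0 : 0 < (1 / 2 : R) by lra.
have [Y [Y_0 Yle PY]] := halving q0 Y00 PY0 step e0.
move=> c d sc cd dsD; apply: (le_trans (PY c d sc cd dsD)).
by rewrite ler_piMl ?powR_ge0//; lra.
Qed.

(** The difference [E] of the solutions is driven by an integrand whose size and Hoelder constant
    are linear in [E0] and in a Hoelder constant [X] of [E]. Iterating [X |-> E0 / 4 + X / 2] brings
    [X] down to about [E0 / 2], so that [E] stays below [2 * E0]. *)
Lemma flow_step x y phi psi :
  solves_flow_eq I U g lam x phi -> solves_flow_eq I U g lam y psi ->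
  forall t, s <= t -> t <= s + D -> `|phi t - psi t| <= 2 * `|phi s - psi s|.
Proof.
move=> Hphi Hpsi.
pose E t := phi t - psi t.
pose P (X : R) := forall c d, s <= c -> c <= d -> d <= s + D ->
    `|E d - E c| <= X * ((d - c) / D) `^ lam.
have ET : 0 < T by apply: lt_le_trans sDT; exact: ltr_wpDl.
have [X0 X00 PX0] : exists2 X, 0 <= X & P X.
  have [Y1 Y10 P1] := solution_holder_scaled (@ler_norm_norm2 R n) (Hphi.1 _ ET).
  have [Y2 Y20 P2] := solution_holder_scaled (@ler_norm_norm2 R n) (Hpsi.1 _ ET).
  exists (Y1 + Y2); first exact: addr_ge0.
  move=> c d sc cd dsD; rewrite mulrDl.
  have -> : E d - E c = (phi d - phi c) - (psi d - psi c).
    by rewrite /E !opprB addrACA [in RHS]addrACA; congr (_ + _); rewrite addrC.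
  by rewrite (le_trans (ler_normB _ _))// lerD// ?P1// P2.
have psi_loc := solution_local Hpsi.
pose q := A * (S * D `^ beta).
have q0 : 0 <= q by rewrite !mulr_ge0 ?powR_ge0.
have sm : 4 * q + 8 * (K * q) <= 1 by apply: le_trans small; rewrite /q; lra.
have Kq0 : 0 <= K * q by rewrite mulr_ge0// ltW.
set E0 := `|E s|.
have E00 : 0 <= E0 := normr_ge0 _.
have step X : 0 <= X -> P X -> P (E0 / 4 + X / 2).
  move=> X_0 PX c d sc cd dsD.
  have c0 := le_trans s0 sc; have d0 := le_trans c0 cd.
  have [Jc [Jd [Hc Hd e1]]] := solution_increment Hphi c0 d0.
  have [Lc [Ld [Gc Gd e2]]] := solution_increment Hpsi c0 d0.
  have -> : E d - E c = \sum_(k <- I) ((Jd k - Ld k) - (Jc k - Lc k)).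
    transitivity ((phi d - phi c) - (psi d - psi c)).
      by rewrite /E !opprB addrACA [in RHS]addrACA; congr (_ + _); rewrite addrC.
    rewrite e1 e2 -sumrB; apply: eq_bigr => k _.
    by rewrite !opprB addrACA [in RHS]addrACA; congr (_ + _); rewrite addrC.
  have Ebnd r : s <= r -> r <= s + D -> `|E r| <= E0 + X.
    move=> sr rsD; have -> : E r = E s + (E r - E s) by rewrite addrC subrK.
    rewrite (le_trans (ler_normD _ _))// lerD2l.
    apply: (le_trans (PX s r (lexx s) sr rsD)); rewrite ler_piMr//.
    apply: powR_le1 (ltW lam0); exact: scale01.
  have a0 : 0 <= A * (E0 + X) by rewrite mulr_ge0// addr_ge0.
  have F0 : 0 <= A * (E0 + 2 * X) by rewrite mulr_ge0// addr_ge0// mulr_ge0.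
  pose f k i (r : R) := U k (phi r) ord0 i - U k (psi r) ord0 i.
  have Ic k i : k \in I -> is_RS_integral (f k i) (g k) 0 c ((Jc k - Lc k) ord0 i).
    by move=> kI; rewrite !mxE; apply: is_RS_integralB; [exact: Hc|exact: Gc].
  have Id k i : k \in I -> is_RS_integral (f k i) (g k) 0 d ((Jd k - Ld k) ord0 i).
    by move=> kI; rewrite !mxE; apply: is_RS_integralB; [exact: Hd|exact: Gd].
  apply: (le_trans (sum_increment_le D0 a0 F0 c0 cd _ _ _ _ Ic Id)).
  - exact: le_trans sDT.
  - lra.
  - move=> k i kI; apply: (le_trans (U_lip _ _ _ kI)); rewrite ler_wpM2l//.
    by apply: Ebnd => //; exact: le_trans dsD.
  - move=> k i y' z kI cy yz zd; have sy := le_trans sc cy.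
    have zs := le_trans zd dsD; have ys := le_trans yz zs.
    (* The shift is changed first, then the base point. The first difference is controlled by the
       increment of [E]; the rest is a second difference with shift [E y'] and base points [psi z],
       [psi y'], which [solution_local] keeps close. *)
    have -> : f k i z - f k i y' =
      (U k (psi z + E z) ord0 i - U k (psi z + E y') ord0 i) +
      ((U k (psi z + E y') ord0 i - U k (psi z) ord0 i) -
       (U k (psi y' + E y') ord0 i - U k (psi y') ord0 i)).
      rewrite /f /E !(addrC (psi _)) !subrK; ring.
    have -> : A * (E0 + 2 * X) * ((z - y') / D) `^ lam =
       A * (X * ((z - y') / D) `^ lam) + A * (E0 + X) * ((z - y') / D) `^ lam by ring.
    rewrite (le_trans (ler_normD _ _))//; apply: lerD.
      apply: (le_trans (U_lip _ _ _ kI)); rewrite ler_wpM2l//.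
      by rewrite opprD addrACA subrr add0r; exact: PX.
    apply: (le_trans (U_diff2 _ _ _ _ kI)); apply: ler_pM => //.
    + by rewrite mulr_ge0.
    + by apply: ler_wpM2l => //; exact: Ebnd.
    + exact: psi_loc.
  - apply: ler_wpM2r; first exact: powR_ge0.
    have -> : S * D `^ beta * (A * (E0 + X) + K * (A * (E0 + 2 * X))) =
      (q + K * q) * E0 + (q + 2 * (K * q)) * X by rewrite /q; ring.
    by apply: lerD; [rewrite (mulrC E0)|rewrite (mulrC X)]; apply: ler_wpM2r => //; lra.
move=> t st tsD.
apply/ler_addgt0Pr => e e0.
have q40 : 0 <= E0 / 4 by lra.
have [X [X_0 Xle PX]] := halving q40 X00 PX0 step e0.
rewrite -/(E t) -/(E s) -/E0; have -> : E t = E s + (E t - E s) by rewrite addrC subrK.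
rewrite (le_trans (ler_normD _ _))// -/E0.
have H1 := PX s t (lexx s) st tsD.
have : X * ((t - s) / D) `^ lam <= X.
  rewrite ler_piMr//; apply: powR_le1 (ltW lam0); exact: scale01.
lra.
Qed.

End Flow.

Section FlowLipschitz.
Variables (R : realType) (n : nat) (I : {fset nat}) (U : nat -> 'rV[R]_n -> 'rV[R]_n).
Variables (g : nat -> R -> R) (lam beta T A : R) (h : nat -> R).
Hypotheses (lam0 : 0 < lam) (lam_beta : lam <= beta) (th1 : 1 < lam + beta).
Hypothesis A0 : 0 <= A.
Hypothesis U_le : forall k x i, k \in I -> `|U k x ord0 i| <= A.
Hypothesis U_lip : forall k x y i, k \in I ->
  `|U k x ord0 i - U k y ord0 i| <= A * `|x - y|.
Hypothesis U_diff2 : forall k p q v i, k \in I ->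
  `|(U k (p + v) ord0 i - U k p ord0 i) - (U k (q + v) ord0 i - U k q ord0 i)| <=
    A * `|v| * `|p - q|.
Hypothesis h0 : forall k, 0 <= h k.
Hypothesis g_holder : forall k x y, k \in I -> 0 <= x -> x <= y -> y <= T ->
  `|g k y - g k x| <= h k * (y - x) `^ beta.
Hypothesis T0 : 0 < T.

Let K := young_const (lam + beta).
Let S := \sum_(k <- I) h k.

Lemma is_RS_integral_point (f g0 : R -> R) a v : is_RS_integral f g0 a a v -> v = 0.
Proof.
move=> H; apply/eqP; rewrite -normr_eq0 eq_le normr_ge0 andbT.
apply/ler_addgt0Pr => e e0; rewrite add0r.
have [eta _ /(_ 0%N (fun _ => a) (fun _ => a) erefl erefl)] := H e e0.
by rewrite big_ord0 sub0r normrN => /(_ (fun k => ltac:(by [])))/ltW.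
Qed.

Lemma solution_at0 x phi : solves_flow_eq I U g lam x phi -> phi 0 = x.
Proof.
move=> [_ /(_ 0 (lexx 0))[J [HJ ->]]].
rewrite big_seq big1 ?addr0// => k kI; apply/rowP => i.
by rewrite (is_RS_integral_point (HJ k i kI)) mxE.
Qed.

Lemma flow_steps (N : nat) x y phi psi : (0 < N)%N ->
  4 * (1 + 2 * K) * A * (S * (T / N%:R) `^ beta) <= 1 ->
  solves_flow_eq I U g lam x phi -> solves_flow_eq I U g lam y psi ->
  forall t, 0 <= t <= T -> `|phi t - psi t| <= 2 ^+ N * `|x - y|.
Proof.
move=> N0 small Hphi Hpsi.
have Nr0 : 0 < N%:R :> R by rewrite ltr0n.
set D := T / N%:R in small.
have D0 : 0 < D by rewrite divr_gt0.
have DN : N%:R * D = T by rewrite mulrC divfK// gt_eqF.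
have Hk k : (k <= N)%N -> forall t, 0 <= t <= k%:R * D ->
    `|phi t - psi t| <= 2 ^+ k * `|x - y|.
  elim: k => [|k IH] kN t.
    rewrite mul0r => /andP[t0 t1]; have -> : t = 0 by apply/eqP; rewrite eq_le t0 t1.
    by rewrite (solution_at0 Hphi) (solution_at0 Hpsi) mul1r.
  move=> /andP[t0 tk]; have [tle|tgt] := lerP t (k%:R * D).
    have {}IH := IH (ltnW kN) t; rewrite t0 tle in IH.
    rewrite exprS -mulrA; apply: (le_trans (IH isT)).
    by rewrite ler_peMl ?mulr_ge0 ?exprn_ge0// ler1n.
  have k0 : 0 <= k%:R * D by rewrite mulr_ge0// ltW.
  have kT : k%:R * D + D <= T.
    have -> : k%:R * D + D = k.+1%:R * D by rewrite -natr1; ring.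
    by rewrite -DN ler_pM2r// ler_nat.
  rewrite exprS -mulrA.
  apply: (le_trans (flow_step lam0 lam_beta th1 A0 U_le U_lip U_diff2 h0 g_holder
    D0 k0 kT small Hphi Hpsi (ltW tgt) _)).
    by have -> : k%:R * D + D = k.+1%:R * D by rewrite -natr1; ring.
  by rewrite ler_pM2l//; apply: IH; rewrite ?(ltnW kN)// k0 lexx.
by move=> t tT; apply: Hk => //; rewrite DN.
Qed.

Lemma flow_lipschitz x y phi psi :
  solves_flow_eq I U g lam x phi -> solves_flow_eq I U g lam y psi ->
  forall t, 0 <= t <= T -> norm2 (phi t - psi t) <=
    (2 * n%:R) * 2 `^ ((4 * (1 + 2 * K) * A * S) `^ beta^-1 * T) * norm2 (x - y).
Proof.
move=> Hphi Hpsi t tT; set Q := 4 * (1 + 2 * K) * A * S; set C := Q `^ _.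
have beta0 : 0 < beta by exact: lt_le_trans lam_beta.
have [_ K0] := young_const_eq th1.
have Q0 : 0 <= Q.
  by rewrite !mulr_ge0// ?sumr_ge0// addr_ge0// mulr_ge0// ltW.
have C0 : 0 <= C by rewrite powR_ge0.
have CT0 : 0 <= C * T by rewrite mulr_ge0// ltW.
have QC : Q = C `^ beta by rewrite /C -powRrM mulVf ?gt_eqF// powRr1.
(* With [N] above [C * T], the step [T / N] satisfies [C * (T / N) < 1], which is the smallness
   condition before raising to the power [beta]. Rounding up costs at most a factor 2 in
   [2 ^+ N]. *)
pose N := (Num.truncn (C * T)).+1.
have /andP[N1 N2] := Num.Theory.truncn_itv CT0.
have Nr0 : 0 < N%:R :> R by rewrite ltr0n.
have small : 4 * (1 + 2 * K) * A * (S * (T / N%:R) `^ beta) <= 1.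
  have TN0 : 0 <= T / N%:R by rewrite divr_ge0// ltW.
  rewrite mulrA -/Q QC -(@powRM _ C (T / N%:R) beta C0 TN0).
  apply: powR_le1; last exact: ltW.
  by rewrite mulr_ge0//= mulrA ler_pdivrMr// mul1r ltW.
have /= H := flow_steps (ltac:(by []) : (0 < N)%N) small Hphi Hpsi tT.
have H2 : 2 ^+ N <= 2 * 2 `^ (C * T) :> R.
  by rewrite exprS ler_wpM2l// -powR_mulrn// ler_powR// ler1n.
apply: (le_trans (ler_norm2_norm _)); apply: (le_trans (ler_wpM2l _ H)) => //.
have -> : 2 * n%:R * 2 `^ (C * T) * norm2 (x - y) =
  n%:R * (2 * 2 `^ (C * T) * norm2 (x - y)) by ring.
by rewrite ler_wpM2l// ler_pM// ?exprn_ge0// ler_norm_norm2.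
Qed.

End FlowLipschitz.

(** * Hausdorff measure under Lipschitz maps *)

Section Hausdorff.
Variables (R : realType) (n m : nat).
Implicit Types A E : set 'rV[R]_n.

Lemma diam2_ge0 E : E !=set0 -> (0 <= diam2 E)%E.
Proof.
move=> [x Ex]; apply: (@le_trans _ _ (norm2 (x - x))%:E).
  by rewrite lee_fin sqrtr_ge0.
by apply: ereal_sup_ubound; exists x, x.
Qed.

Lemma diam_pow_ge0 E : (0 <= diam_pow m E)%E.
Proof.
rewrite /diam_pow; case: asboolP => // /eqP/set0P E0.
by rewrite expe_ge0// diam2_ge0.
Qed.

Lemma hausdorff_pre_ge0 d A : (0 <= hausdorff_pre m d A)%E.
Proof.
apply/ereal_infP => _ [E [_ _ ->]]; apply: nneseries_ge0 => k _ _.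
exact: diam_pow_ge0.
Qed.

Lemma hausdorff_ge0 A : (0 <= hausdorff m A)%E.
Proof.
apply: (le_trans (hausdorff_pre_ge0 1 A)); apply: ereal_sup_ubound.
by exists 1 => //=.
Qed.

Lemma diam2_image (f : 'rV[R]_n -> 'rV[R]_n) (L : R) E : 0 < L ->
  (forall x y, norm2 (f x - f y) <= L * norm2 (x - y)) ->
  (diam2 (f @` E) <= L%:E * diam2 E)%E.
Proof.
move=> L0 Hf; apply/ereal_supP => _ [_ [_ [[x Ex <-] [y Ey <-] ->]]].
apply: (@le_trans _ _ (L%:E * (norm2 (x - y))%:E)%E).
  by rewrite -EFinM lee_fin.
rewrite lee_pmul2l//; apply: ereal_sup_ubound.
by exists x, y.
Qed.

(** Covers of [A] at scale [d / L] are mapped to covers of the image at scale [d], each weight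
    growing by at most [L ^+ m]; the supremum over all scales removes the change of scale. *)
Lemma hausdorff_image (f : 'rV[R]_n -> 'rV[R]_n) (L : R) A : 0 < L ->
  (forall x y, norm2 (f x - f y) <= L * norm2 (x - y)) ->
  (hausdorff m (f @` A) <= (L ^+ m)%:E * hausdorff m A)%E.
Proof.
move=> L0 Hf; have Lm0 : 0 < L ^+ m by rewrite exprn_gt0.
apply/ereal_supP => _ [d d0 <-].
have dL0 : 0 < d / L by rewrite divr_gt0.
apply: (@le_trans _ _ ((L ^+ m)%:E * hausdorff_pre m (d / L) A)%E); last first.
  by rewrite lee_pmul2l//; apply: ereal_sup_ubound; exists (d / L).
rewrite -lee_pdivrMl//; apply/ereal_infP => _ [E [AE Ed ->]].
rewrite lee_pdivrMl//.
apply: (@le_trans _ _ (\sum_(0 <= k <oo) diam_pow m (f @` E k))%E).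
  apply: ereal_inf_lbound; exists (fun k => f @` E k); split => //.
    by move=> _ [x /AE[k _ Ekx] <-]; exists k => //; exists x.
  move=> k; apply: (le_trans (diam2_image _ L0 Hf)).
  apply: (@le_trans _ _ (L%:E * (d / L)%:E)%E); first by rewrite lee_pmul2l.
  by rewrite -EFinM mulrC divfK ?gt_eqF.
rewrite -nneseriesZl; last by move=> k _; exact: diam_pow_ge0.
apply: lee_nneseries => k; first by move=> _ _; exact: diam_pow_ge0.
move=> _.
(* Empty sets are treated apart: their weight is 0 by convention, while their [diam2] is -oo. *)
rewrite [leLHS]/diam_pow; case: asboolP => [_|fE].
  by apply: mule_ge0; [rewrite lee_fin ltW|exact: diam_pow_ge0].
rewrite /diam_pow; case: asboolP => [E0|/eqP/set0P E0]; first by case: fE; rewrite E0 image_set0.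
have dE0 := diam2_ge0 E0.
have dfE0 : (0 <= diam2 (f @` E k))%E.
  by apply: diam2_ge0; apply/set0P/eqP.
have H := diam2_image (E k) L0 Hf.
rewrite EFin_expe; elim: m => [|p IH]; first by rewrite !expe0 mul1e.
by rewrite !expeS muleACA; apply: lee_pmul => //; exact: expe_ge0.
Qed.

End Hausdorff.

(** * A Cramer-Wold argument *)

Section StepPolynomials.
Variable R : realType.

Lemma bernoulli_le (y : R) M : 0 <= y <= 1 -> 1 - M%:R * y <= (1 - y) ^+ M.
Proof.
move=> /andP[y0 y1]; elim: M => [|M IH]; first by rewrite mul0r subr0 expr0.
rewrite exprSr; apply: (@le_trans _ _ ((1 - M%:R * y) * (1 - y))); last first.
  by apply: ler_wpM2r => //; rewrite subr_ge0.
rewrite -natr1; have : 0 <= M%:R * y * y by rewrite !mulr_ge0.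
lra.
Qed.

Lemma expr_le_inv (y : R) M : 0 <= y <= 1 -> (1 - y) ^+ M <= (1 + M%:R * y)^-1.
Proof.
move=> /andP[y0 y1].
have pos k : 0 < 1 + k%:R * y by rewrite ltr_pwDl// mulr_ge0.
rewrite -[leRHS]mul1r ler_pdivlMr//.
elim: M => [|M IH]; first by rewrite mul0r addr0 expr0 mulr1.
apply: le_trans IH; rewrite exprSr -mulrA ler_wpM2l ?exprn_ge0 ?subr_ge0//.
rewrite -natr1; have : 0 <= M%:R * y * y by rewrite !mulr_ge0.
have : 0 <= y * y by rewrite mulr_ge0.
lra.
Qed.

(** Writing [r = s ^+ 2], one factor [s ^+ N] keeps [N * s ^+ N] below [(1 - s)^-1] and the other
    tends to 0. *)
Lemma cvg_natM_expr (r : R) : 0 <= r < 1 -> (fun N => N%:R * r ^+ N) @ \oo --> (0 : R).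
Proof.
move=> /andP[r0 r1]; set s := Num.sqrt r.
have s0 : 0 <= s by exact: sqrtr_ge0.
have s1 : s < 1 by rewrite /s -sqrtr1 ltr_sqrt.
have rs : r = s ^+ 2 by rewrite sqr_sqrtr.
apply: (@squeeze_cvgr _ _ _ _ (fun=> 0) (fun N => (1 - s)^-1 * s ^+ N)).
- near=> N; rewrite mulr_ge0 ?exprn_ge0//= rs -exprM mulnC exprM expr2 mulrA.
  rewrite ler_wpM2r ?exprn_ge0//.
  have : s ^+ N <= (1 + N%:R * (1 - s))^-1.
    have -> : s ^+ N = (1 - (1 - s)) ^+ N by congr (_ ^+ _); ring.
    by apply: expr_le_inv; apply/andP; split; lra.
  move=> /(ler_wpM2l (ler0n _ N)) /le_trans; apply.
  rewrite ler_pdivrMr ?ltr_pwDl// ?mulr_ge0 ?subr_ge0 ?(ltW s1)//.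
  rewrite ler_pdivlMl ?subr_gt0//; lra.
- exact: cvg_cst.
- by have := @cvg_geometric R (1 - s)^-1 s; apply; rewrite ger0_norm.
Unshelve. all: by end_near. Qed.

(** The step polynomials of elementary proofs of Stone-Weierstrass. The product of [u ^+ N] and the
    outer exponent is [N * (2 * u) ^+ N], which tends to 0 for [u < 1 / 2] and is at least [N]
    otherwise; the extra factor [N] in the exponent decides the boundary case [u = 1 / 2]. *)
Lemma step_cvg (u : R) : 0 <= u <= 1 ->
  (fun N => (1 - u ^+ N) ^+ (N * 2 ^ N)) @ \oo --> (if u < 1 / 2 then 1 else 0 : R).
Proof.
move=> /andP[u0 u1].
have uN N : 0 <= u ^+ N <= 1 by rewrite exprn_ge0// exprn_ile1.
have e N : (N * 2 ^ N)%:R * u ^+ N = N%:R * (2 * u) ^+ N.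
  by rewrite natrM natrX exprMn mulrA.
case: ltP => hu.
  apply: (@squeeze_cvgr _ _ _ _ (fun N => 1 - N%:R * (2 * u) ^+ N) (fun=> 1)).
  - near=> N; rewrite -e bernoulli_le//= exprn_ile1//.
      by rewrite subr_ge0; have /andP[] := uN N.
    by rewrite gerBl; have /andP[] := uN N.
  - rewrite -[X in _ --> X]subr0; apply: cvgB; first exact: cvg_cst.
    by apply: cvg_natM_expr; rewrite mulr_ge0//=; lra.
  - exact: cvg_cst.
apply: (@squeeze_cvgr _ _ _ _ (fun=> 0) (@harmonic R)).
- near=> N; rewrite exprn_ge0 ?subr_ge0//=; last by have /andP[] := uN N.
  apply: (le_trans (expr_le_inv _ (uN N))); rewrite e /harmonic/=.
  rewrite lef_pV2 ?posrE ?ltr_pwDl// ?mulr_ge0 ?exprn_ge0 ?mulr_ge0//.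
  rewrite -natr1 addrC lerD2l -[leLHS]mulr1 ler_wpM2l// exprn_ege1//; lra.
- exact: cvg_cst.
- exact: cvg_harmonic.
Unshelve. all: by end_near. Qed.

(* For [x != z] the sign of [sin ((x - z) / (k + 1))] is eventually that of
   [x - z]. *)
Lemma sin_scaled_sign_cvg (x z : R) :
  (fun k => if (1 + sin (k.+1%:R^-1 * (x - z))) / 2 < 1 / 2 then 1 else 0 : R)
    @ \oo --> (if x < z then 1 else 0 : R).
Proof.
apply: cvg_near_cst; near=> k.
have k0 : 0 < k.+1%:R^-1 :> R by rewrite invr_gt0.
have small : `|k.+1%:R^-1 * (x - z)| < 2.
  rewrite normrM gtr0_norm// mulrC ltr_pdivrMr//.
  have : `|x - z| < k%:R by near: k; exact: nbhs_infty_gtr.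
  rewrite -natr1; have := normr_ge0 (x - z); lra.
case: (ltgtP x z) => xz.
- have -> // : (1 + sin (k.+1%:R^-1 * (x - z))) / 2 < 1 / 2.
  have : 0 < sin (k.+1%:R^-1 * (z - x)).
    apply: sin2_gt0; rewrite mulr_gt0 ?subr_gt0//=.
    by apply: le_lt_trans small; rewrite -normrN -mulrN opprB ler_norm.
  rewrite -opprB mulrN sinN; lra.
- suff : 0 < sin (k.+1%:R^-1 * (x - z)) by case: ifPn => // + ?; lra.
  apply: sin2_gt0; rewrite mulr_gt0 ?subr_gt0//=.
  by apply: le_lt_trans small; rewrite ler_norm.
- by rewrite xz subrr mulr0 sin0 addr0 ltxx.
Unshelve. all: by end_near. Qed.

End StepPolynomials.

Definition bounded_measurable (R : realType) d (T : measurableType d) (G : T -> R) :=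
  measurable_fun setT G /\ exists C, forall w, `|G w| <= C.

Section BoundedMeasurable.
Context (R : realType) (d : measure_display) (T : measurableType d).
Variable P : probability T R.
Implicit Types G : T -> R.

Lemma bounded_measurable_integrable G :
  bounded_measurable G -> P.-integrable setT (EFin \o G).
Proof.
move=> [mG [C GC]]; apply: measurable_bounded_integrable => //.
  by rewrite [X in (X < _)%E]probability_setT ltry.
by exists C; split; [exact: num_real|move=> y Cy w _ /=; rewrite (le_trans (GC w)) ?ltW].
Qed.

Lemma bounded_measurableD G1 G2 : bounded_measurable G1 -> bounded_measurable G2 ->
  bounded_measurable (fun w => G1 w + G2 w).
Proof.
move=> [m1 [C1 H1]] [m2 [C2 H2]]; split; first exact: measurable_funD.
by exists (C1 + C2) => w; rewrite (le_trans (ler_normD _ _))// lerD.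
Qed.

Lemma bounded_measurableM G1 G2 : bounded_measurable G1 -> bounded_measurable G2 ->
  bounded_measurable (fun w => G1 w * G2 w).
Proof.
move=> [m1 [C1 H1]] [m2 [C2 H2]]; split; first exact: measurable_funM.
by exists (C1 * C2) => w; rewrite normrM ler_pM.
Qed.

Lemma bounded_measurable_cst (c : R) : bounded_measurable (fun _ : T => c).
Proof. by split; [exact: measurable_cst|exists `|c|]. Qed.

Lemma bounded_measurable_cos (Z : T -> R) b : measurable_fun setT Z ->
  bounded_measurable (fun w => cos (Z w + b)).
Proof.
move=> mZ; split.
  apply: (measurableT_comp (f := fun x => cos x)).
    by apply: continuous_measurable_fun; exact: continuous_cos.
  by apply: measurable_funD.
by exists 1 => w; rewrite ler_norml cos_geN1 cos_le1.
Qed.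

End BoundedMeasurable.

Section CramerWold.
Context (R : realType) (d d' : measure_display).
Context (T : measurableType d) (T' : measurableType d').
Variables (P : probability T R) (P' : probability T' R).
(** [L] pairs a variable with its counterpart on the other space; in the application, the same
    linear combination of two processes. *)
Variable L : (T -> R) -> (T' -> R) -> Prop.
Hypothesis L_lin : forall Z1 Z1' Z2 Z2' (a b : R), L Z1 Z1' -> L Z2 Z2' ->
  L (fun w => a * Z1 w + b * Z2 w) (fun w => a * Z1' w + b * Z2' w).
Hypothesis L_meas : forall Z Z', L Z Z' -> measurable_fun setT Z /\ measurable_fun setT Z'.
Hypothesis L_cos : forall Z Z' b, L Z Z' ->
  (\int[P]_w (cos (Z w + b))%:E = \int[P']_w (cos (Z' w + b))%:E)%E.

(** Testing against all cosines, and not only against 1, makes the relation stable under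
    multiplication by a cosine: the product of two cosines is a sum of cosines of variables that are
    again paired by [L]. *)
Definition matched (G : T -> R) (G' : T' -> R) : Prop :=
  [/\ bounded_measurable G, bounded_measurable G' &
  forall Z Z' b, L Z Z' ->
  (\int[P]_w (G w * cos (Z w + b))%:E = \int[P']_w (G' w * cos (Z' w + b))%:E)%E].

Lemma matched1 : matched (fun=> 1) (fun=> 1).
Proof.
split; try exact: bounded_measurable_cst.
move=> Z Z' b /(L_cos b); congr (_ = _);
  by apply: eq_integral => w _; rewrite mul1r.
Qed.

Lemma matched_lin G1 G1' G2 G2' (a b : R) : matched G1 G1' -> matched G2 G2' ->
  matched (fun w => a * G1 w + b * G2 w) (fun w => a * G1' w + b * G2' w).
Proof.
move=> [b1 b1' H1] [b2 b2' H2].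
have bl d0 (T0 : measurableType d0) (A B : T0 -> R) : bounded_measurable A ->
    bounded_measurable B -> bounded_measurable (fun w => a * A w + b * B w).
  move=> bA bB; apply: bounded_measurableD; apply: bounded_measurableM => //;
  exact: bounded_measurable_cst.
split; [exact: bl|exact: bl|].
move=> Z Z' c LZ; have [mZ mZ'] := L_meas LZ.
have E d0 (T0 : measurableType d0) (Q : probability T0 R) (A B Z0 : T0 -> R) :
    bounded_measurable A -> bounded_measurable B -> measurable_fun setT Z0 ->
    (\int[Q]_w ((a * A w + b * B w) * cos (Z0 w + c))%:E =
     a%:E * \int[Q]_w (A w * cos (Z0 w + c))%:E +
     b%:E * \int[Q]_w (B w * cos (Z0 w + c))%:E)%E.
  move=> bA bB mZ0; have bc := bounded_measurable_cos c mZ0.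
  have iA := bounded_measurable_integrable Q (bounded_measurableM bA bc).
  have iB := bounded_measurable_integrable Q (bounded_measurableM bB bc).
  rewrite -integralZl// -integralZl// -integralD//; try exact: integrableZl.
  by apply: eq_integral => w _; rewrite /= -!EFinM -EFinD; congr EFin; ring.
by rewrite !E// (H1 _ _ c LZ) (H2 _ _ c LZ).
Qed.

Lemma matched_cos G G' Z Z' b : matched G G' -> L Z Z' ->
  matched (fun w => G w * cos (Z w + b)) (fun w => G' w * cos (Z' w + b)).
Proof.
move=> [bG bG' HG] LZ; have [mZ mZ'] := L_meas LZ.
split; [|by apply: bounded_measurableM => //; exact: bounded_measurable_cos|].
  by apply: bounded_measurableM => //; exact: bounded_measurable_cos.
move=> Y Y' c LY; have [mY mY'] := L_meas LY.
have E d0 (T0 : measurableType d0) (Q : probability T0 R) (A Z0 Y0 : T0 -> R) :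
    bounded_measurable A -> measurable_fun setT Z0 -> measurable_fun setT Y0 ->
    (\int[Q]_w (A w * cos (Z0 w + b) * cos (Y0 w + c))%:E =
     (2^-1)%:E * (\int[Q]_w (A w * cos ((1 * Z0 w + 1 * Y0 w) + (b + c)))%:E +
       \int[Q]_w (A w * cos ((1 * Z0 w + (-1) * Y0 w) + (b - c)))%:E))%E.
  move=> bA mZ0 mY0.
  have m1 : measurable_fun setT (fun w => 1 * Z0 w + 1 * Y0 w).
    by apply: measurable_funD; apply: measurable_funM.
  have m2 : measurable_fun setT (fun w => 1 * Z0 w + (-1) * Y0 w).
    by apply: measurable_funD; apply: measurable_funM.
  have i1 := bounded_measurable_integrable Q
    (bounded_measurableM bA (bounded_measurable_cos (b + c) m1)).
  have i2 := bounded_measurable_integrable Q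
    (bounded_measurableM bA (bounded_measurable_cos (b - c) m2)).
  rewrite -integralD// -integralZl//; last exact: integrableD.
  apply: eq_integral => w _; rewrite /= -!EFinD -EFinM; congr EFin.
  have -> : 1 * Z0 w + 1 * Y0 w + (b + c) = (Z0 w + b) + (Y0 w + c) by ring.
  have -> : 1 * Z0 w + -1 * Y0 w + (b - c) = (Z0 w + b) - (Y0 w + c) by ring.
  by move: (Z0 w + b) (Y0 w + c) => x y; rewrite cosB cosD; field.
rewrite !E//; congr (_ * (_ + _))%E; apply: HG; exact: L_lin.
Qed.

Lemma matched_lim (G_ : nat -> T -> R) (G'_ : nat -> T' -> R) (G : T -> R) (G' : T' -> R) (C : R) :
  (forall k, matched (G_ k) (G'_ k)) ->
  (forall k w, `|G_ k w| <= C) -> (forall k w, `|G'_ k w| <= C) ->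
  (forall w, G_ ^~ w @ \oo --> G w) -> (forall w, G'_ ^~ w @ \oo --> G' w) ->
  matched G G'.
Proof.
move=> HG GC GC' Gcvg Gcvg'.
have bl d0 (T0 : measurableType d0) (A_ : nat -> T0 -> R) (A : T0 -> R) :
    (forall k, bounded_measurable (A_ k)) -> (forall k w, `|A_ k w| <= C) ->
    (forall w, A_ ^~ w @ \oo --> A w) -> bounded_measurable A.
  move=> bA AC Acvg; split.
    by apply: (@measurable_fun_cvg _ _ _ _ A_ A) => [k|w _]; [have [] := bA k|exact: Acvg].
  exists C => w; apply: (cvgr_to_le (cvg_norm (Acvg w))).
  by near=> k; exact: AC.
split.
- by apply: (bl _ _ G_) => // k; have [] := HG k.
- by apply: (bl _ _ G'_) => // k; have [] := HG k.
move=> Z Z' b LZ; have [mZ mZ'] := L_meas LZ.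
have E d0 (T0 : measurableType d0) (Q : probability T0 R) (A_ : nat -> T0 -> R) (A Z0 : T0 -> R) :
    (forall k, bounded_measurable (A_ k)) -> (forall k w, `|A_ k w| <= C) ->
    (forall w, A_ ^~ w @ \oo --> A w) -> measurable_fun setT Z0 ->
    (fun k => \int[Q]_w (A_ k w * cos (Z0 w + b))%:E)%E @ \oo -->
    (\int[Q]_w (A w * cos (Z0 w + b))%:E)%E.
  move=> bA AC Acvg mZ0.
  apply: (@dominated_cvg _ _ _ Q setT _ _ _ (fun=> C%:E)) => //.
  - move=> k; apply/measurable_EFinP; apply: measurable_funM; first by have [] := bA k.
    by have [] := bounded_measurable_cos b mZ0.
  - move=> w _; apply/cvg_EFin; first by near=> k.
    by apply: cvgM; [exact: Acvg|exact: cvg_cst].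
  - exact: (bounded_measurable_integrable Q (bounded_measurable_cst _ C)).
  - move=> k w _ /=; rewrite lee_fin normrM.
    have C0 : 0 <= C := le_trans (normr_ge0 _) (AC k w).
    rewrite -[leRHS]mulr1 ler_pM// ler_norml cos_geN1 cos_le1//.
have E1 := E _ _ P G_ G Z (fun k => ltac:(by have [] := HG k)) GC Gcvg mZ.
have E2 := E _ _ P' G'_ G' Z' (fun k => ltac:(by have [] := HG k)) GC' Gcvg' mZ'.
have EE : (fun k => \int[P]_w (G_ k w * cos (Z w + b))%:E)%E =
    (fun k => \int[P']_w (G'_ k w * cos (Z' w + b))%:E)%E.
  by apply/funext => k; have [_ _ h] := HG k; exact: h.
by rewrite EE in E1; exact: cvg_unique E1 E2.
Unshelve. all: by end_near. Qed.

(** Multipliers act on matched pairs and hence compose; powers, and products over several variables,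
    need no further argument. *)
Definition multiplier (u : T -> R) (u' : T' -> R) : Prop :=
  forall G G', matched G G' -> matched (fun w => G w * u w) (fun w => G' w * u' w).

Lemma multiplier_lin u u' v v' (a b : R) : multiplier u u' -> multiplier v v' ->
  multiplier (fun w => a * u w + b * v w) (fun w => a * u' w + b * v' w).
Proof.
move=> mu mv G G' GG'; have := matched_lin a b (mu _ _ GG') (mv _ _ GG').
by congr matched; apply/funext => w; ring.
Qed.

Lemma multiplier_ext u u' v v' : multiplier u u' -> u =1 v -> u' =1 v' ->
  multiplier v v'.
Proof. by move=> mu /funext <- /funext <-. Qed.

Lemma multiplier1 : multiplier (fun=> 1) (fun=> 1).
Proof.
move=> G G'; rewrite (_ : (fun w => G w * 1) = G); last by apply/funext => w; rewrite mulr1.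
by rewrite (_ : (fun w => G' w * 1) = G')//; apply/funext => w; rewrite mulr1.
Qed.

Lemma multiplier_exp u u' N : multiplier u u' ->
  multiplier (fun w => u w ^+ N) (fun w => u' w ^+ N).
Proof.
move=> mu; elim: N => [|N IH]; first exact: multiplier1.
move=> G G' GG'; have := mu _ _ (IH _ _ GG').
by congr matched; apply/funext => w; rewrite exprSr mulrA.
Qed.

Lemma multiplier_lim (u_ : nat -> T -> R) (u'_ : nat -> T' -> R) (u : T -> R) (u' : T' -> R) :
  (forall k, multiplier (u_ k) (u'_ k)) ->
  (forall k w, `|u_ k w| <= 1) -> (forall k w, `|u'_ k w| <= 1) ->
  (forall w, u_ ^~ w @ \oo --> u w) -> (forall w, u'_ ^~ w @ \oo --> u' w) ->
  multiplier u u'.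
Proof.
move=> mu u1 u1' ulim ulim' G G' GG'; have [[_ [C GC]] [_ [C' GC']] _] := GG'.
apply: (@matched_lim (fun k w => G w * u_ k w) (fun k w => G' w * u'_ k w) _ _ (`|C| + `|C'|)).
- by move=> k; exact: mu.
- move=> k w; rewrite normrM -[leRHS]mulr1 ler_pM//.
  by rewrite (le_trans (GC w))// (le_trans (ler_norm _))// lerDl.
- move=> k w; rewrite normrM -[leRHS]mulr1 ler_pM//.
  by rewrite (le_trans (GC' w))// (le_trans (ler_norm _))// lerDr.
- by move=> w; apply: cvgM; [exact: cvg_cst|exact: ulim].
- by move=> w; apply: cvgM; [exact: cvg_cst|exact: ulim'].
Qed.

(** Two successive limits. For a fixed frequency [a], letting [N] grow yields the indicator of
    [sin (a * (Z - z)) < 0]; letting [a] tend to 0 then yields that of [Z < z]. All intermediate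
    functions are bounded by 1. *)
Lemma multiplier_lt Z Z' (z : R) : L Z Z' ->
  multiplier (fun w => if Z w < z then 1 else 0) (fun w => if Z' w < z then 1 else 0).
Proof.
move=> LZ.
pose u (a : R) d0 (T0 : measurableType d0) (Y : T0 -> R) w := (1 + sin (a * (Y w - z))) / 2.
have u01 a d0 (T0 : measurableType d0) (Y : T0 -> R) w : 0 <= u a _ _ Y w <= 1.
  rewrite /u; have := sin_le1 (a * (Y w - z)); have := sin_geN1 (a * (Y w - z)).
  by move=> h1 h2; apply/andP; split; lra.
have mu a : multiplier (u a _ _ Z) (u a _ _ Z').
  (* The sine is a cosine with shifted phase; the term [0 * Z w] only matches the shape of
     [L_lin]. *)
  have mc : multiplier (fun w => cos ((a * Z w + 0 * Z w) + (- (a * z) - pi / 2)))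
                       (fun w => cos ((a * Z' w + 0 * Z' w) + (- (a * z) - pi / 2))).
    by move=> G G' GG'; apply: matched_cos => //; exact: L_lin.
  have e (y : R) : sin (a * (y - z)) = cos (a * y + 0 * y + (- (a * z) - pi / 2)).
    by rewrite -sinDpihalf; congr sin; field.
  by apply: (multiplier_ext (multiplier_lin (1 / 2) (1 / 2) multiplier1 mc)) => w;
    rewrite /u e; field.
pose p (a : R) N d0 (T0 : measurableType d0) (Y : T0 -> R) w :=
  (1 - u a _ _ Y w ^+ N) ^+ (N * 2 ^ N).
have p1 a N d0 (T0 : measurableType d0) (Y : T0 -> R) w : `|p a N _ _ Y w| <= 1.
  have /andP[u0 u1] := u01 a _ _ Y w.
  have v0 : 0 <= u a _ _ Y w ^+ N by rewrite exprn_ge0.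
  have v1 : u a _ _ Y w ^+ N <= 1 by rewrite exprn_ile1.
  by rewrite /p normrX exprn_ile1// ger0_norm; lra.
have mp a N : multiplier (p a N _ _ Z) (p a N _ _ Z').
  apply: multiplier_exp.
  by apply: (multiplier_ext (multiplier_lin 1 (-1) multiplier1
    (multiplier_exp N (mu a)))) => w; ring.
pose s (a : R) d0 (T0 : measurableType d0) (Y : T0 -> R) w : R :=
  if u a _ _ Y w < 1 / 2 then 1 else 0.
have ms a : multiplier (s a _ _ Z) (s a _ _ Z').
  apply: (multiplier_lim (mp a) (fun N => @p1 a N _ _ Z) (fun N => @p1 a N _ _ Z')).
  - by move=> w; apply: step_cvg; exact: u01.
  - by move=> w; apply: step_cvg; exact: u01.
have s1 a d0 (T0 : measurableType d0) (Y : T0 -> R) w : `|s a _ _ Y w| <= 1.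
  by rewrite /s; case: ifP; rewrite ?normr1 ?normr0.
apply: (multiplier_lim (fun k : nat => ms k.+1%:R^-1) (fun k : nat => @s1 k.+1%:R^-1 _ _ Z)
  (fun k : nat => @s1 k.+1%:R^-1 _ _ Z')).
- by move=> w; exact: sin_scaled_sign_cvg.
- by move=> w; exact: sin_scaled_sign_cvg.
Qed.

Lemma multiplier_le Z Z' (z : R) : L Z Z' ->
  multiplier (fun w => (Z w <= z)%R%:R) (fun w => (Z' w <= z)%R%:R).
Proof.
move=> LZ; have L' := L_lin (-1) 0 LZ LZ.
have e (y : R) : (y <= z)%R%:R = 1 * 1 + -1 * (if -1 * y + 0 * y < - z then 1 else 0) :> R.
  have -> : -1 * y + 0 * y = - y by ring.
  rewrite ltrN2; case: (leP y z) => _ /=; lra.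
by apply: (multiplier_ext (multiplier_lin 1 (-1) multiplier1 (multiplier_lt (- z) L')))
  => w; rewrite e.
Qed.

Lemma joint_cdf_eq k (Z_ : 'I_k -> T -> R) (Z'_ : 'I_k -> T' -> R) (z : 'I_k -> R) :
  (exists Z Z', L Z Z') -> (forall i, L (Z_ i) (Z'_ i)) ->
  P [set w | forall i, Z_ i w <= z i] = P' [set w | forall i, Z'_ i w <= z i].
Proof.
(* The zero combination turns the test cosine into the constant 1, which recovers plain
   probabilities at the end. *)
move=> [Z [Z' LZ]] LZ_; have L0 := L_lin 0 0 LZ LZ.
have : multiplier (fun w => \prod_(i < k) (Z_ i w <= z i)%R%:R)
                  (fun w => \prod_(i < k) (Z'_ i w <= z i)%R%:R).
  elim: k => [|k IH] in Z_ Z'_ z LZ_ *.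
    by apply: (multiplier_ext multiplier1) => w; rewrite big_ord0.
  move=> G G' GG'.
  have H0 := multiplier_le (z ord0) (LZ_ ord0) GG'.
  have := IH (fun i => Z_ (lift ord0 i)) (fun i => Z'_ (lift ord0 i))
    (fun i => z (lift ord0 i)) (fun i => LZ_ (lift ord0 i)) _ _ H0.
  by congr matched; apply/funext => w; rewrite big_ord_recl mulrA.
move=> /(_ _ _ matched1)[_ _ /(_ _ _ 0 L0)].
have E d0 (T0 : measurableType d0) (Q : probability T0 R) (Y_ : 'I_k -> T0 -> R) (Y : T0 -> R) :
    (forall i, measurable_fun setT (Y_ i)) ->
    (\int[Q]_w (1 * \prod_(i < k) (Y_ i w <= z i)%R%:R * cos (0 * Y w + 0 * Y w + 0))%:E)%E =
    Q [set w | forall i, Y_ i w <= z i].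
  move=> mY; have mA : measurable [set w | forall i, Y_ i w <= z i].
    rewrite (_ : mkset _ = \bigcap_(i in [set: 'I_k]) (Y_ i @^-1` [set x | x <= z i])).
      apply: fin_bigcap_measurable; first exact: finite_finset.
      by move=> i _; rewrite -[X in measurable X]setTI; apply: mY => //; rewrite -set_itvNyc.
    by apply/seteqP; split => [w H i _|w H i]; [exact: H|exact: (H i)].
  transitivity (\int[Q]_w (\1_[set w | forall i, Y_ i w <= z i] w)%:E)%E; last first.
    by rewrite integral_indic// setIT.
  apply: eq_integral => w _.
  rewrite !mul0r !addr0 cos0 mulr1 mul1r indicE; congr EFin.
  have [H|H] := pselect (forall i, Y_ i w <= z i).
    by rewrite mem_set// big1// => i _; rewrite H.
  rewrite memNset//; have /existsNP[i /negP Hi] := H.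
  by rewrite (bigD1 i)//= (negbTE Hi) mul0r.
by rewrite !E// => i; have [] := L_meas (LZ_ i).
Qed.

End CramerWold.

(** * Gaussian variables *)

Section NormalMoments.
Variable R : realType.
Implicit Types m s a c r : R.

Lemma ge0_integral_normal_prob m s (f : R -> \bar R) : s != 0 ->
  measurable_fun setT f -> (forall x, 0 <= f x)%E ->
  (\int[normal_prob m s]_x f x =
   \int[lebesgue_measure]_x (f x * (normal_pdf m s x)%:E))%E.
Proof.
move=> s0 mf f0.
rewrite -(@Radon_Nikodym_SigmaFinite.change_of_variables _ _ R (normal_prob m s)
  lebesgue_measure (normal_prob_dominates m s) f setT)//.
apply: ae_eq_integral => //.
- apply: emeasurable_funM => //; apply: (measurable_int lebesgue_measure).
  apply: Radon_Nikodym_SigmaFinite.f_integrable; exact: normal_prob_dominates.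
- apply: emeasurable_funM => //; apply/measurable_EFinP; exact: measurable_normal_pdf.
- apply: ae_eqe_mul2l => /=.
  apply: integral_ae_eq => //=.
  + apply: Radon_Nikodym_SigmaFinite.f_integrable; exact: normal_prob_dominates.
  + by apply/measurable_EFinP; exact: measurable_normal_pdf.
  + move=> E _ mE; rewrite -Radon_Nikodym_SigmaFinite.f_integral//.
    exact: normal_prob_dominates.
Qed.

(** Completing the square: an exponential tilt moves the mean and keeps the deviation. *)
Lemma normal_pdf_expR m s a x : s != 0 ->
  expR (a * x) * normal_pdf m s x =
  expR (a * m + a ^+ 2 * s ^+ 2 / 2) * normal_pdf (m + a * s ^+ 2) s x.
Proof.
move=> s0; rewrite !normal_pdfE// /normal_fun.
rewrite mulrCA [RHS]mulrCA -!expRD; congr (_ * expR _).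
rewrite -mulr_natl; field; rewrite s0//.
Qed.

(** A tilt by the exponential of a square rescales the deviation. Taking the ratio [r] of the
    deviations as parameter makes the total mass simply [r]. *)
Lemma normal_pdf_expR_sqr s r x : s != 0 -> 0 < r ->
  expR ((1 - r ^- 2) / (2 * s ^+ 2) * x ^+ 2) * normal_pdf 0 s x =
  r * normal_pdf 0 (r * s) x.
Proof.
move=> s0 r0; have rs0 : r * s != 0 by rewrite mulf_neq0// gt_eqF.
rewrite !normal_pdfE// /normal_fun mulrCA -expRD !subr0.
have -> : normal_peak s = r * normal_peak (r * s).
  rewrite /normal_peak.
  have -> : (r * s) ^+ 2 * pi *+ 2 = r ^+ 2 * (s ^+ 2 * pi *+ 2).
    by rewrite !mulr2n; ring.
  rewrite sqrtrM ?sqr_ge0// sqrtr_sqr gtr0_norm//.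
  by rewrite invfM mulrA divff ?mul1r// gt_eqF.
rewrite [RHS]mulrA; congr (_ * expR _).
rewrite !mulr2n; field.
have h (y : R) : y != 0 -> y ^+ 2 + y ^+ 2 != 0.
  by rewrite -mulr2n mulrn_eq0 sqrf_eq0.
by rewrite !h// s0 gt_eqF.
Qed.

End NormalMoments.

Section GaussianVariables.
Variable R : realType.

(* The mean of a normal law is read off [expR] dominating its tangent lines:
   its exponential moments are explicit, and so it suffices to let the slope
   tend to 0. *)
Lemma expR_sqr_tangent (d q : R) : 0 <= q ->
  (forall a, 1 + a * d <= expR (a ^+ 2 * q)) -> d = 0.
Proof.
move=> q0 H; apply/eqP; apply/negPn/negP => d0.
have D0 : 0 < d ^+ 2 by rewrite exprn_even_gt0.
set D := d ^+ 2 in D0.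
(* With [a = t * d] the left side gains [t * D], linear in [t], while the exponent is quadratic in
   [t]. This [t] makes both [t * q] and [t * D] less than [1 / 2], enough for a contradiction. *)
pose t := ((1 + q) * (1 + D) * 2)^-1.
have t0 : 0 < t by rewrite invr_gt0 !mulr_gt0//; lra.
have te : t * ((1 + q) * (1 + D) * 2) = 1 by rewrite mulVf// gt_eqF// !mulr_gt0//; lra.
have tq0 : 0 <= t * q by rewrite mulr_ge0// ltW.
have tD0 : 0 < t * D by rewrite mulr_gt0.
have tqD0 : 0 <= t * q * D by rewrite mulr_ge0// ltW.
have tq : t * q < 1 / 2 by lra.
have tD : t * D < 1 / 2 by lra.
have := H (t * d).
have -> : t * d * d = t * D by rewrite /D; ring.
have -> : (t * d) ^+ 2 * q = (t * D) * (t * q) by rewrite /D; ring.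
set y := t * D * (t * q).
have y1 : y <= 1 / 2 * (1 / 2) by apply: ler_pM; lra.
have y0 : 0 <= y by rewrite mulr_ge0// ltW.
have := expR_ge1Dx (- y); rewrite expRN => h1 h2.
have : (1 + t * D) * (1 - y) <= 1.
  have eV : expR y / expR y = 1 by rewrite divff// gt_eqF// expR_gt0.
  rewrite -[leRHS]eV; apply: ler_pM => //; lra.
have : t * D * (t * q) < t * D * (1 / 2) by rewrite ltr_pM2l.
have : y * (t * D) <= y * (1 / 2) by rewrite ler_wpM2l// ltW.
rewrite -/y; lra.
Qed.

(** Both sides equal 1 at [r = 1], so an inequality on both sides of that point forces the
    derivatives [2 * q] and 1 to agree. For [q = v / (2 * s ^+ 2)] this identifies the variance in
    [normal_variance]. *)
Lemma inv_sqr_tangent (q : R) : 0 <= q ->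
  (forall r, 0 < r -> 1 + (1 - r ^- 2) * q <= r) -> q = 1 / 2.
Proof.
move=> q0 H.
have H' r : 0 < r -> r ^+ 2 + (r ^+ 2 - 1) * q <= r ^+ 3.
  move=> r0; have := ler_wpM2r (sqr_ge0 r) (H r r0).
  have -> : (1 + (1 - r ^- 2) * q) * r ^+ 2 = r ^+ 2 + (r ^+ 2 - 1) * q.
    by field; rewrite gt_eqF.
  by have -> : r * r ^+ 2 = r ^+ 3 by ring.
apply/eqP; rewrite eq_le; apply/andP; split.
- apply/ler_addgt0Pr => e e0.
  pose t := Num.min 1 (e / 3).
  have t0 : 0 < t by rewrite lt_min ltr01 divr_gt0.
  have t1 : t <= 1 by rewrite ge_min lexx.
  have te : t <= e / 3 by rewrite ge_min lexx orbT.
  have r0 : 0 < 1 + t by lra.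
  have : t * (q * (2 + t)) <= t * (1 + t) ^+ 2 by have := H' _ r0; lra.
  rewrite ler_pM2l// => h.
  have qt : 0 <= q * t by rewrite mulr_ge0// ltW.
  have tt : t * t <= t by rewrite ler_piMl// ltW.
  lra.
- apply/ler_addgt0Pr => e e0.
  pose t := Num.min (1 / 2) e.
  have t0 : 0 < t by rewrite lt_min e0 andbT; lra.
  have t1 : t <= 1 / 2 by rewrite ge_min lexx.
  have te : t <= e by rewrite ge_min lexx orbT.
  have r0 : 0 < 1 - t by lra.
  have : t * (1 - t) ^+ 2 <= t * (q * (2 - t)) by have := H' _ r0; lra.
  rewrite ler_pM2l// => h.
  have qt : 0 <= q * t by rewrite mulr_ge0// ltW.
  have tt : 0 <= t * t by rewrite mulr_ge0// ltW.
  lra.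
Qed.

Context (d : measure_display) (T : measurableType d) (P : probability T R).

(** A plain set function, so that the degenerate and the nondegenerate case of [gaussian_rv] share
    one formula. *)
Definition normal_law (m s : R) (A : set R) : \bar R :=
  if s == 0 then \d_m A else normal_prob m s A.

Definition has_law (X : T -> R) (nu : set R -> \bar R) : Prop :=
  measurable_fun setT X /\ forall A, measurable A -> P (X @^-1` A) = nu A.

Lemma has_law_integral X (nu : probability (measurableTypeR R) R) (f : R -> \bar R) : has_law X nu ->
  measurable_fun setT f -> (forall x, 0 <= f x)%E ->
  (\int[P]_w f (X w) = \int[nu]_x f x)%E.
Proof.
move=> [mX PX] mf f0.
pose X' : {mfun T >-> measurableTypeR R} :=
  HB.pack X (isMeasurableFun.Build _ _ _ (measurableTypeR R) X mX).
transitivity (\int[pushforward P X']_x f x)%E.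
  by rewrite ge0_integral_pushforward.
apply: (@eq_measure_integral _ (measurableTypeR R) R setT nu (pushforward P X')).
by move=> A mA _; exact: PX.
Qed.

Lemma has_normal_law_integral X m s (f : R -> R) : has_law X (normal_law m s) ->
  measurable_fun setT f -> (forall x, 0 <= f x) ->
  (\int[P]_w (f (X w))%:E = if (s == 0)%R then (f m)%:E else
    \int[lebesgue_measure]_x (f x * normal_pdf m s x)%:E)%E.
Proof.
move=> PX mf f0; have mf' : measurable_fun setT (EFin \o f) by apply/measurable_EFinP.
have f0' x : (0 <= (EFin \o f) x)%E by rewrite lee_fin.
have [s0|s0] := eqVneq s 0.
  have PX' : has_law X (\d_m : set R -> \bar R).
    by case: PX => mX PX; split => // A /PX; rewrite /normal_law s0 eqxx.
  rewrite (has_law_integral (nu := @dirac _ (measurableTypeR R) m R) PX' mf' f0').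
  by rewrite integral_dirac// diracT mul1e.
have PX' : has_law X (normal_prob m s).
  by case: PX => mX PX; split => // A /PX; rewrite /normal_law (negbTE s0).
rewrite (has_law_integral (nu := normal_prob m s) PX' mf' f0').
by rewrite ge0_integral_normal_prob//; apply: eq_integral => x _; rewrite EFinM.
Qed.

Lemma normal_mgf X m s a : has_law X (normal_law m s) ->
  (\int[P]_w (expR (a * X w))%:E = (expR (a * m + a ^+ 2 * s ^+ 2 / 2))%:E)%E.
Proof.
move=> PX; have mf : measurable_fun setT (fun x : R => expR (a * x)).
  by apply: measurableT_comp => //; exact: measurable_funM.
rewrite (has_normal_law_integral PX mf (fun x => expR_ge0 _)).
have [->|s0] := eqVneq s 0; first by rewrite expr0n/= mulr0 mul0r addr0.
under eq_integral do rewrite normal_pdf_expR// EFinM.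
rewrite integralZl//; last exact: integrable_normal_pdf.
by rewrite integral_normal_pdf mule1.
Qed.

Lemma normal_exp_sqr X s r : has_law X (normal_law 0 s) -> s != 0 -> 0 < r ->
  (\int[P]_w (expR ((1 - r ^- 2) / (2 * s ^+ 2) * X w ^+ 2))%:E = r%:E)%E.
Proof.
move=> PX s0 r0; set c := _ / _.
have mf : measurable_fun setT (fun x : R => expR (c * x ^+ 2)).
  by apply: measurableT_comp => //; apply: measurable_funM => //; exact: measurable_funX.
rewrite (has_normal_law_integral PX mf (fun x => expR_ge0 _)) (negbTE s0).
under eq_integral do rewrite normal_pdf_expR_sqr// EFinM.
rewrite integralZl//; last exact: integrable_normal_pdf.
by rewrite integral_normal_pdf mule1.
Qed.

Lemma normal_expR_integrable X m s a : has_law X (normal_law m s) ->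
  P.-integrable setT (fun w => (expR (a * X w))%:E).
Proof.
move=> PX; apply/integrableP; split.
  apply/measurable_EFinP; apply: measurableT_comp => //.
  by apply: measurable_funM => //; case: PX.
under eq_integral do rewrite gee0_abs ?lee_fin ?expR_ge0//.
by rewrite (normal_mgf a PX) ltry.
Qed.

Lemma normal_integrable X m s : has_law X (normal_law m s) ->
  P.-integrable setT (fun w => (X w)%:E).
Proof.
move=> PX; have I1 := normal_expR_integrable 1 PX.
have I2 := normal_expR_integrable (-1) PX.
apply: (le_integrable measurableT _ _ (integrableD measurableT I1 I2)).
  by apply/measurable_EFinP; case: PX.
move=> w _ /=; rewrite lee_fin [leRHS]ger0_norm ?addr_ge0 ?expR_ge0//.
rewrite mul1r mulN1r ler_norml.
have := expR_ge1Dx (X w); have := expR_ge1Dx (- X w).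
have := expR_ge0 (X w); have := expR_ge0 (- X w); move=> *; apply/andP; split; lra.
Qed.

Lemma normal_sqr_integrable X m s : has_law X (normal_law m s) ->
  P.-integrable setT (fun w => (X w ^+ 2)%:E).
Proof.
move=> PX; have I1 := normal_expR_integrable 2 PX.
have I2 := normal_expR_integrable (-2) PX.
apply: (le_integrable measurableT _ _ (integrableD measurableT I1 I2)).
  by apply/measurable_EFinP; apply: measurable_funX; case: PX.
have bnd (x : R) : 0 <= x -> x ^+ 2 <= expR (2 * x).
  move=> x0; rewrite mulrC expRM powR_mulrn ?expR_ge0//.
  by rewrite lerXn2r ?nnegrE ?expR_ge0// (le_trans _ (expR_ge1Dx x))//; lra.
move=> w _ /=; rewrite lee_fin ger0_norm ?sqr_ge0//.
rewrite [leRHS]ger0_norm ?addr_ge0 ?expR_ge0//.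
have := expR_ge0 (2 * X w); have := expR_ge0 (-2 * X w).
have [X0|X0] := lerP 0 (X w); first by have := bnd _ X0; lra.
have := bnd (- X w) ltac:(lra); rewrite sqrrN mulrN mulNr; lra.
Qed.

Lemma normal_mean X m s : has_law X (normal_law m s) ->
  (\int[P]_w (X w)%:E = m%:E)%E.
Proof.
move=> PX; have IX := normal_integrable PX.
have /fineK Ee := integrable_fin_num measurableT IX.
rewrite -Ee; congr EFin; set e := fine _ in Ee *.
apply/eqP; rewrite -subr_eq0; apply/eqP.
apply: (@expR_sqr_tangent _ (s ^+ 2 / 2)); first by rewrite divr_ge0 ?sqr_ge0.
move=> a; rewrite -lee_fin.
have -> : (expR (a ^+ 2 * (s ^+ 2 / 2)))%:E =
  ((expR (- (a * m)))%:E * \int[P]_w (expR (a * X w))%:E)%E.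
  rewrite (normal_mgf a PX) -EFinM -expRD; congr (expR _)%:E; ring.
rewrite -integralZl//; last exact: normal_expR_integrable PX.
have -> : (1 + a * (e - m))%:E = (\int[P]_w (1 - a * m + a * X w)%:E)%E.
  under eq_integral do rewrite EFinD EFinM.
  rewrite integralD//.
  - rewrite integralZl// -Ee integral_cst// [X in (_ * X)%E]probability_setT mule1.
    by rewrite -EFinM -EFinD; congr EFin; ring.
  - exact: (bounded_measurable_integrable P (bounded_measurable_cst _ _)).
  - exact: integrableZl.
apply: le_integral => //.
- under eq_fun do rewrite EFinD EFinM.
  apply: integrableD => //; last exact: integrableZl.
  exact: (bounded_measurable_integrable P (bounded_measurable_cst _ _)).
- by apply: integrableZl => //; exact: normal_expR_integrable PX.
- move=> w _; rewrite -EFinM lee_fin -expRD.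
  by apply: le_trans (expR_ge1Dx _); lra.
Qed.

Lemma normal_variance X s v : has_law X (normal_law 0 s) ->
  (\int[P]_w (X w ^+ 2)%:E = v%:E)%E -> v = s ^+ 2.
Proof.
move=> PX Ev; have IX := normal_sqr_integrable PX.
have [s0|s0] := eqVneq s 0.
  move: Ev; rewrite (has_normal_law_integral (f := fun x => x ^+ 2) PX).
  - by rewrite s0 eqxx => -[<-].
  - exact: measurable_funX.
  - by move=> x; exact: sqr_ge0.
have s20 : 0 < s ^+ 2 by rewrite exprn_even_gt0.
have v0 : 0 <= v.
  by rewrite -lee_fin -Ev integral_ge0// => w _; rewrite lee_fin sqr_ge0.
suff : v / (2 * s ^+ 2) = 1 / 2.
  move=> h; have : v = v / (2 * s ^+ 2) * (2 * s ^+ 2).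
    by rewrite divfK// mulf_neq0// gt_eqF.
  by rewrite h => ->; field.
apply: inv_sqr_tangent; first by rewrite divr_ge0// mulr_ge0 ?sqr_ge0.
move=> r r0; rewrite -lee_fin -(normal_exp_sqr PX s0 r0).
set c := (1 - r ^- 2) / (2 * s ^+ 2).
have -> : (1 + (1 - r ^- 2) * (v / (2 * s ^+ 2)))%:E =
    (\int[P]_w (1 + c * X w ^+ 2)%:E)%E.
  under eq_integral do rewrite EFinD EFinM.
  rewrite integralD//.
  - rewrite integralZl// Ev integral_cst// [X in (_ * X)%E]probability_setT mule1.
    by rewrite -EFinM -EFinD; congr EFin; rewrite /c; ring.
  - exact: (bounded_measurable_integrable P (bounded_measurable_cst _ _)).
  - exact: integrableZl.
apply: le_integral => //.
- under eq_fun do rewrite EFinD EFinM.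
  apply: integrableD => //; last exact: integrableZl.
  exact: (bounded_measurable_integrable P (bounded_measurable_cst _ _)).
- apply/integrableP; split.
    apply/measurable_EFinP; apply: measurableT_comp => //.
    by apply: measurable_funM => //; apply: measurable_funX; case: PX.
  under eq_integral do rewrite gee0_abs ?lee_fin ?expR_ge0//.
  by rewrite (normal_exp_sqr PX s0 r0) ltry.
- by move=> w _; rewrite lee_fin; exact: expR_ge1Dx.
Qed.

Lemma gaussian_rvP X : gaussian_rv P X ->
  exists m s, has_law X (normal_law m s).
Proof. by move=> [mX [m [s H]]]; exists m, s; split. Qed.

(** [gaussian_rv] leaves the mean and the deviation unspecified, the latter even in sign. The first
    two moments determine the mean and [s ^+ 2], and the density is even in [s]. *)
Lemma centered_gaussian_law X (v : R) : gaussian_rv P X ->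
  (\int[P]_w (X w)%:E = 0)%E -> (\int[P]_w (X w ^+ 2)%:E = v%:E)%E ->
  has_law X (normal_law 0 (Num.sqrt v)).
Proof.
move=> /gaussian_rvP[m [s PX]] E0 Ev.
have m0 : m = 0 by move: E0; rewrite (normal_mean PX) => -[].
rewrite m0 in PX; have -> := normal_variance PX Ev.
rewrite sqrtr_sqr; suff -> : normal_law 0 `|s| = normal_law 0 s by [].
have [->|s0] := eqVneq s 0; first by rewrite normr0.
have ns0 : (`|s| == 0) = false by rewrite normr_eq0 (negbTE s0).
apply/funext => A; rewrite /normal_law ns0 (negbTE s0) /normal_prob.
suff -> : normal_pdf 0 `|s| = normal_pdf 0 s by [].
rewrite !normal_pdfE ?normr_eq0//; apply/funext => x.
by rewrite /normal_peak /normal_fun -normrX ger0_norm ?sqr_ge0.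
Qed.

End GaussianVariables.

(** * Laws of linear combinations of fractional Brownian motion *)

Section FractionalBrownianMotion.
Context (R : realType) (d : measure_display) (T : measurableType d).
Variables (P : probability T R) (H : R) (B : R -> T -> R).
Hypothesis hB : fBm P H B.

Definition fBm_cov (H s t : R) : R :=
  2^-1 * (t `^ (2 * H) + s `^ (2 * H) - `|t - s| `^ (2 * H)).

Lemma fBm_gaussian_rv t : 0 <= t -> gaussian_rv P (B t).
Proof.
move=> t0; case: hB => /(_ 1%N (fun=> t) (fun=> 1) (fun=> t0)) + _ _ _.
by congr gaussian_rv; apply/funext => w; rewrite big_ord1 mul1r.
Qed.

Lemma fBm_measurable t : 0 <= t -> measurable_fun setT (B t).
Proof. by move=> /fBm_gaussian_rv[]. Qed.

Lemma fBm_integral t : 0 <= t ->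
  P.-integrable setT (fun w => (B t w)%:E) /\ (\int[P]_w (B t w)%:E = 0)%E.
Proof.
move=> t0; have [m [s PX]] := gaussian_rvP (fBm_gaussian_rv t0).
split; first exact: normal_integrable PX.
by have [_ /(_ _ t0) + _ _] := hB; rewrite unlock.
Qed.

Lemma fBm_integral_mul s t : 0 <= s -> 0 <= t ->
  P.-integrable setT (fun w => (B s w * B t w)%:E) /\
  (\int[P]_w (B s w * B t w)%:E = (fBm_cov H s t)%:E)%E.
Proof.
move=> s0 t0; have [m [sg PX]] := gaussian_rvP (fBm_gaussian_rv s0).
have [m' [sg' PY]] := gaussian_rvP (fBm_gaussian_rv t0).
split; last by have [_ _ /(_ _ _ s0 t0) + _] := hB; rewrite unlock.
apply: (le_integrable measurableT _ _ (integrableD measurableT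
  (normal_sqr_integrable PX) (normal_sqr_integrable PY))).
  by apply/measurable_EFinP; apply: measurable_funM; exact: fBm_measurable.
move=> w _ /=; rewrite lee_fin [leRHS]ger0_norm ?addr_ge0 ?sqr_ge0//.
rewrite ler_norml; have := sqr_ge0 (B s w + B t w); have := sqr_ge0 (B s w - B t w).
move=> h1 h2.
have := sqr_ge0 (B s w); have := sqr_ge0 (B t w); move=> h3 h4.
by apply/andP; split; lra.
Qed.

Definition fBm_variance (k : nat) (H : R) (t a : 'I_k -> R) : R :=
  \sum_(i < k) \sum_(j < k) a i * a j * fBm_cov H (t i) (t j).

(** The law is a function of [H], the times and the weights alone, which makes two such processes
    comparable. *)
Lemma fBm_combination_law k (t a : 'I_k -> R) : (forall i, 0 <= t i) ->
  has_law P (fun w => \sum_(i < k) a i * B (t i) w)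
    (normal_law 0 (Num.sqrt (fBm_variance H t a))).
Proof.
move=> t0; apply: centered_gaussian_law.
- by case: hB => + _ _ _; exact.
- under eq_integral do rewrite -sumEFin.
  rewrite integral_sum//; last first.
    move=> i; under eq_fun do rewrite EFinM.
    by apply: integrableZl => //; have [] := fBm_integral (t0 i).
  rewrite big1// => i _; under eq_integral do rewrite EFinM.
  have [Ii Ei] := fBm_integral (t0 i).
  by rewrite integralZl// Ei mule0.
- have E w : ((\sum_(i < k) a i * B (t i) w) ^+ 2)%:E =
    (\sum_(i < k) \sum_(j < k) (a i * a j)%:E * (B (t i) w * B (t j) w)%:E)%E.
    rewrite expr2 mulr_suml -sumEFin; apply: eq_bigr => i _.
    rewrite mulr_sumr -sumEFin; apply: eq_bigr => j _.
    by rewrite -EFinM; congr EFin; ring.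
  under eq_integral do rewrite E.
  have I i j : P.-integrable setT (fun w => ((a i * a j)%:E * (B (t i) w * B (t j) w)%:E)%E).
    by apply: integrableZl => //; have [] := fBm_integral_mul (t0 i) (t0 j).
  rewrite integral_sum//; last by move=> i; apply: integrable_sum => //.
  rewrite -sumEFin; apply: eq_bigr => i _.
  rewrite integral_sum// -sumEFin; apply: eq_bigr => j _.
  have [Ii Ei] := fBm_integral_mul (t0 i) (t0 j).
  by rewrite integralZl// Ei -EFinM.
Qed.

Lemma fBm_increment_law s t : 0 <= s -> 0 <= t -> 0 < H ->
  has_law P (fun w => B t w - B s w) (normal_law 0 (`|t - s| `^ H)).
Proof.
move=> s0 t0 H0.
pose tt (i : 'I_2) := if i == ord0 then t else s.
pose aa (i : 'I_2) : R := if i == ord0 then 1 else -1.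
have tt0 i : 0 <= tt i by rewrite /tt; case: ifP.
have := fBm_combination_law aa tt0.
have -> : (fun w => \sum_(i < 2) aa i * B (tt i) w) = (fun w => B t w - B s w).
  by apply/funext => w; rewrite big_ord_recl big_ord1 /aa /tt/= mul1r mulN1r.
suff -> : fBm_variance H tt aa = (`|t - s| `^ H) ^+ 2.
  by rewrite sqrtr_sqr ger0_norm// powR_ge0.
rewrite /fBm_variance !big_ord_recl !big_ord0 /aa /tt/= /fBm_cov.
rewrite !subrr normr0 powR0 ?mulf_neq0 ?gt_eqF// (distrC s t).
have -> : (`|t - s| `^ H) ^+ 2 = `|t - s| `^ (2 * H).
  by rewrite -powR_mulrn ?powR_ge0// -powRrM mulrC.
by field.
Qed.

End FractionalBrownianMotion.

(** * Hoelder seminorms through dyadic points *)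

Section Dyadic.
Variables (R : realType) (T : R).
Hypothesis T0 : 0 < T.
Implicit Types (f : R -> R) (x c d : R).

Definition dyadic_point (n k : nat) : R := T * k%:R / 2 ^+ n.
Definition dyadic_index (n : nat) x : nat := Num.truncn (2 ^+ n * x / T).
Let pt := dyadic_point.
Let ix := dyadic_index.

Let p2 n : 0 < 2 ^+ n :> R. Proof. exact: exprn_gt0. Qed.

Lemma dyadic_point_double n k : pt n.+1 k.*2 = pt n k.
Proof.
rewrite /pt /dyadic_point exprS -muln2 natrM; field.
by rewrite gt_eqF.
Qed.

Lemma dyadic_point_ge0 n k : 0 <= pt n k.
Proof. by rewrite /pt /dyadic_point divr_ge0 ?mulr_ge0 ?(ltW T0)// ltW. Qed.

Lemma dyadic_pointB n i j : pt n j - pt n i = T * (j%:R - i%:R) / 2 ^+ n.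
Proof. by rewrite /pt /dyadic_point; ring. Qed.

Lemma dyadic_point_le n k : (k <= 2 ^ n)%N -> pt n k <= T.
Proof.
move=> kn; rewrite /pt /dyadic_point ler_pdivrMr// ler_pM2l//.
by rewrite -natrX ler_nat.
Qed.

Lemma dyadic_index_itv n x : 0 <= x ->
  (ix n x)%:R <= 2 ^+ n * x / T /\ 2 ^+ n * x / T < (ix n x).+1%:R.
Proof.
move=> x0; have /Num.Theory.truncn_itv/andP[] // : 0 <= 2 ^+ n * x / T.
by rewrite divr_ge0 ?mulr_ge0 ?(ltW T0)// ltW.
Qed.

Lemma dyadic_index_le n x : 0 <= x -> x <= T -> (ix n x <= 2 ^ n)%N.
Proof.
move=> x0 xT; have [h _] := dyadic_index_itv n x0.
rewrite -(ler_nat R) (le_trans h)// natrX ler_pdivrMr// ler_pM2l//.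
Qed.

Lemma dyadic_point_index n x : 0 <= x ->
  pt n (ix n x) <= x /\ x - pt n (ix n x) <= T / 2 ^+ n.
Proof.
move=> x0; have [h1 h2] := dyadic_index_itv n x0.
have e : 2 ^+ n * x / T * (T / 2 ^+ n) = x by field; rewrite !gt_eqF.
have e' : pt n (ix n x) = (ix n x)%:R * (T / 2 ^+ n) by rewrite /pt /dyadic_point; ring.
have s0 : 0 < T / 2 ^+ n by rewrite divr_gt0.
have := ler_wpM2r (ltW s0) h1; have := ler_wpM2r (ltW s0) (ltW h2).
rewrite e e' -natr1 => g1 g2; split => //; lra.
Qed.

Lemma dyadic_indexS n x : 0 <= x ->
  ix n.+1 x = (ix n x).*2 \/ ix n.+1 x = (ix n x).*2.+1.
Proof.
move=> x0; have [h1 h2] := dyadic_index_itv n x0.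
have [g1 g2] := dyadic_index_itv n.+1 x0.
have e : 2 ^+ n.+1 * x / T = (2 ^+ n * x / T) * 2 by rewrite exprS; ring.
rewrite e in g1 g2.
have k1 : ((ix n x).*2 < (ix n.+1 x).+1)%N.
  rewrite -(ltr_nat R); apply: le_lt_trans g2; rewrite -muln2 natrM; lra.
have k2 : (ix n.+1 x < (ix n x).*2.+2)%N.
  rewrite -(ltr_nat R); apply: (le_lt_trans g1).
  have -> : (ix n x).*2.+2%:R = (ix n x).+1%:R * 2 :> R.
    by rewrite -natrM muln2.
  lra.
move: k1; rewrite ltnS leq_eqVlt => /orP[/eqP ->|k1]; first by left.
by right; apply/eqP; rewrite eqn_leq k1 -ltnS k2.
Qed.

Lemma dyadic_point_cvg x : 0 <= x -> (fun n => pt n (ix n x)) @ \oo --> x.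
Proof.
move=> x0; apply: (@squeeze_cvgr _ _ _ _ (fun n => x - geometric T (2^-1) n) (fun=> x)).
- near=> n; have [h1 h2] := dyadic_point_index n x0.
  rewrite h1 andbT /geometric/= exprVn; lra.
- rewrite -[X in _ --> X]subr0; apply: cvgB; first exact: cvg_cst.
  by apply: cvg_geometric; rewrite ger0_norm; lra.
- exact: cvg_cst.
Unshelve. all: by end_near. Qed.

Lemma within_continuous_cvg f (u : nat -> R) x : {within `[0, +oo[, continuous f} ->
  0 <= x -> (forall n, 0 <= u n) -> u @ \oo --> x -> (fun n => f (u n)) @ \oo --> f x.
Proof.
move=> /subspace_continuousP cf x0 u0 ux.
have Ax : `[0, +oo[%classic x by rewrite /= in_itv/= x0.
have H := cf x Ax.
move=> A hA; apply: (@filterS _ \oo _ _ _ _ (ux _ (H _ hA))) => n /=; apply.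
by rewrite in_itv/= u0.
Qed.

(** Every pair [c < d] is a limit of dyadic pairs of a common level, and the quotient is continuous
    there since the denominator stays away from 0. Both the measurability and the law of the
    seminorm rest on this reduction to countably many pairs. *)
Lemma holder_dyadic_le f (beta : R) (z : \bar R) :
  {within `[0, +oo[, continuous f} -> 0 < beta ->
  (forall n i j, (i < j <= 2 ^ n)%N ->
    ((`|f (pt n j) - f (pt n i)| / (pt n j - pt n i) `^ beta)%:E <= z)%E) ->
  (holder_seminorm Num.norm beta T f <= z)%E.
Proof.
move=> cf b0 H; apply/ereal_supP => _ [c [d [c0 cd dT ->]]].
have d0 : 0 <= d by lra.
have cT : c <= T by lra.
have Dc := dyadic_point_cvg c0; have Dd := dyadic_point_cvg d0.
have pc n := dyadic_point_ge0 n (ix n c); have pd n := dyadic_point_ge0 n (ix n d).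
have Fc := within_continuous_cvg cf c0 pc Dc.
have Fd := within_continuous_cvg cf d0 pd Dd.
have dc0 : 0 < d - c by rewrite subr_gt0.
have cvgd : (fun n => pt n (ix n d) - pt n (ix n c)) @ \oo --> d - c by exact: cvgB.
have cvgden : (fun n => (pt n (ix n d) - pt n (ix n c)) `^ beta) @ \oo --> (d - c) `^ beta.
  apply: (cvg_comp (fun n => pt n (ix n d) - pt n (ix n c)) (fun x => x `^ beta)).
    exact: cvgd.
  have /derivable1_diffP/differentiable_continuous :
    derivable (fun x : R => x `^ beta) (d - c) 1 by have [] := is_derive1_powR beta dc0.
  exact.
have cvgr : (fun n => `|f (pt n (ix n d)) - f (pt n (ix n c))| /
    (pt n (ix n d) - pt n (ix n c)) `^ beta) @ \oo --> `|f d - f c| / (d - c) `^ beta.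
  apply: cvgM; first by apply: cvg_norm; exact: cvgB.
  by apply: cvgV => //; rewrite gt_eqF// powR_gt0.
rewrite (gtr0_norm dc0).
apply: (@cvge_to_le _ \oo _ _ (fun n => (`|f (pt n (ix n d)) - f (pt n (ix n c))| /
    (pt n (ix n d) - pt n (ix n c)) `^ beta)%:E)).
  by apply/cvg_EFin; [near=> n|exact: cvgr].
near=> n; apply: H; rewrite dyadic_index_le// andbT.
have : pt n (ix n c) < pt n (ix n d).
  by rewrite -subr_gt0; near: n; exact: (cvgr_gt _ cvgd).
by rewrite /pt /dyadic_point ltr_pM2r ?invr_gt0// ltr_pM2l// ltr_nat.
Unshelve. all: by end_near. Qed.

(** By [dyadic_indexS], refining the level leaves the dyadic point below [x] in place or moves it by
    one step of the new level. Each level thus costs at most one increment, and the costs form a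
    geometric series. *)
Lemma dyadic_chain f (C q : R) : 0 < q < 1 -> 0 <= C ->
  (forall n k, (k < 2 ^ n)%N -> `|f (pt n k.+1) - f (pt n k)| <= C * q ^+ n) ->
  forall x, 0 <= x -> x <= T -> forall n j,
  `|f (pt (n + j) (ix (n + j) x)) - f (pt n (ix n x))| <= C * q ^+ n / (1 - q).
Proof.
move=> /andP[q0 q1] C0 H x x0 xT n j.
have q1' : 0 < 1 - q by rewrite subr_gt0.
suff : `|f (pt (n + j) (ix (n + j) x)) - f (pt n (ix n x))| <=
    C * q ^+ n * (1 - q ^+ j) / (1 - q).
  move=> /le_trans; apply; rewrite ler_pM2r ?invr_gt0// ler_piMr//.
    by rewrite mulr_ge0// exprn_ge0// ltW.
  by rewrite gerBl exprn_ge0// ltW.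
elim: j => [|j IH].
  by rewrite addn0 subrr normr0 expr0 subrr mulr0 mul0r.
have step : `|f (pt (n + j).+1 (ix (n + j).+1 x)) - f (pt (n + j) (ix (n + j) x))| <=
    C * q ^+ (n + j).+1.
  have Cq m : 0 <= C * q ^+ m by rewrite mulr_ge0// exprn_ge0// ltW.
  rewrite -[pt (n + j) _]dyadic_point_double.
  have [-> | E] := dyadic_indexS (n + j) x0; first by rewrite subrr normr0.
  rewrite E; apply: H.
  by rewrite -E; exact: dyadic_index_le.
rewrite addnS.
have -> : f (pt (n + j).+1 (ix (n + j).+1 x)) - f (pt n (ix n x)) =
  (f (pt (n + j).+1 (ix (n + j).+1 x)) - f (pt (n + j) (ix (n + j) x))) +
  (f (pt (n + j) (ix (n + j) x)) - f (pt n (ix n x))) by ring.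
apply: (le_trans (ler_normD _ _)); apply: (le_trans (lerD step IH)).
rewrite ler_pdivlMr// mulrDl divfK ?gt_eqF// exprSr exprD (exprSr q j).
have : 0 <= C * (q ^+ n * q ^+ j) * ((1 - q) * (1 - q)).
  by rewrite !mulr_ge0 ?exprn_ge0// ltW.
lra.
Qed.

Lemma holder_chaining f (beta C : R) : {within `[0, +oo[, continuous f} -> 0 < beta ->
  (forall n k, (k < 2 ^ n)%N ->
    `|f (pt n k.+1) - f (pt n k)| <= C * (2 `^ (- beta)) ^+ n) ->
  (holder_seminorm Num.norm beta T f < +oo)%E.
Proof.
move=> cf b0 H; set q := 2 `^ (- beta) in H.
have q0 : 0 < q by rewrite powR_gt0.
have q1 : q < 1.
  rewrite /q powRN invf_lt1 ?powR_gt0//.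
  rewrite /powR (_ : (2 == 0 :> R) = false) ?pnatr_eq0// -[ltLHS]expR0 ltr_expR.
  by rewrite mulr_gt0// ln_gt0// ltr1n.
have q1' : 0 < 1 - q by rewrite subr_gt0.
have C0 : 0 <= C by have := H 0%N 0%N isT; rewrite expr0 mulr1; apply: le_trans.
have qn n : q ^+ n = (2 ^- n) `^ beta.
  by rewrite /q -powR_mulrn ?powR_ge0// -powRrM mulNr mulrC -mulNr powRrM powRN
    powR_mulrn.
have approx x n : 0 <= x -> x <= T -> `|f x - f (pt n (ix n x))| <= C * q ^+ n / (1 - q).
  move=> x0 xT.
  have Fx := within_continuous_cvg cf x0 (fun n => dyadic_point_ge0 n _) (dyadic_point_cvg x0).
  have Fx' : (fun j => f (pt (j + n) (ix (j + n) x))) @ \oo --> f x.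
    by rewrite (cvg_shiftn n (fun m => f (pt m (ix m x)))).
  have N : (fun j => `|f (pt (j + n) (ix (j + n) x)) - f (pt n (ix n x))|) @ \oo -->
     `|f x - f (pt n (ix n x))|.
    by apply: cvg_norm; apply: cvgB => //; exact: cvg_cst.
  apply: (cvgr_to_le N); near=> j; rewrite addnC.
  by apply: dyadic_chain => //; rewrite q0.
(* One chain for each endpoint, plus one increment between their approximations. *)
set K := 2 * (C / (1 - q)) + C.
have K0 : 0 <= K by rewrite addr_ge0// mulr_ge0// divr_ge0// ltW.
apply: (@le_lt_trans _ _ (K * (2 / T) `^ beta)%:E); last exact: ltry.
apply/ereal_supP => _ [c [d [c0 cd dT ->]]].
have d0 : 0 <= d by lra.
have cT : c <= T by lra.
have dc0 : 0 < d - c by rewrite subr_gt0.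
rewrite (gtr0_norm dc0) lee_fin ler_pdivrMr ?powR_gt0//.
(* At this level the approximations of [c] and [d] coincide or are neighbours, by the first bound;
   the second bounds [q ^+ n] by a multiple of [(d - c)^beta]. *)
have [n [n1 n2]] : exists n, d - c <= T / 2 ^+ n /\ T / 2 ^+ n.+1 < d - c.
  have ex : exists n, T / 2 ^+ n < d - c.
    exists (Num.bound (T / (d - c))).
    by rewrite ltr_pdivrMr// mulrC -ltr_pdivrMr//; exact: upper_nthrootP.
  case: (ex_minnP ex) => -[|n].
    by rewrite expr0 divr1 => h _; exfalso; lra.
  move=> h /(_ n) hmin; exists n; split => //.
  by rewrite leNgt; apply/negP => /hmin; rewrite ltnn.
have mid : `|f (pt n (ix n d)) - f (pt n (ix n c))| <= C * q ^+ n.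
  have Cq : 0 <= C * q ^+ n by rewrite mulr_ge0// exprn_ge0// ltW.
  have [c1 c2] := dyadic_index_itv n c0; have [d1 d2] := dyadic_index_itv n d0.
  have e : 2 ^+ n * d / T - 2 ^+ n * c / T <= 1.
    have -> : 2 ^+ n * d / T - 2 ^+ n * c / T = (d - c) / (T / 2 ^+ n).
      by field; rewrite !gt_eqF.
    by rewrite ler_pdivrMr ?mul1r// divr_gt0.
  have e' : 0 < 2 ^+ n * d / T - 2 ^+ n * c / T.
    have -> : 2 ^+ n * d / T - 2 ^+ n * c / T = (d - c) * (2 ^+ n / T) by ring.
    by rewrite mulr_gt0// divr_gt0.
  have k1 : (ix n c < (ix n d).+1)%N by rewrite -(ltr_nat R); lra.
  have k2 : (ix n d < (ix n c).+2)%N.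
    by rewrite -(ltr_nat R) -natr1; lra.
  move: k1; rewrite ltnS leq_eqVlt => /orP[/eqP ->|k1]; first by rewrite subrr normr0.
  have -> : ix n d = (ix n c).+1 by apply/eqP; rewrite eqn_leq k1 -ltnS k2.
  by apply: H; apply: leq_trans (dyadic_index_le n d0 dT).
have -> : f d - f c = (f d - f (pt n (ix n d))) - (f c - f (pt n (ix n c))) +
  (f (pt n (ix n d)) - f (pt n (ix n c))) by ring.
apply: (@le_trans _ _ (K * q ^+ n)).
  have -> : K * q ^+ n = C * q ^+ n / (1 - q) + C * q ^+ n / (1 - q) + C * q ^+ n.
    by rewrite /K; ring.
  apply: (le_trans (ler_normD _ _)); apply: lerD => //.
  by apply: (le_trans (ler_normB _ _)); apply: lerD; exact: approx.
have T20 : 0 <= 2 / T by rewrite divr_ge0// ltW.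
rewrite -mulrA; apply: ler_wpM2l => //.
rewrite qn -(powRM _ T20 (ltW dc0)); apply: ge0_ler_powR.
- exact: ltW.
- by rewrite nnegrE invr_ge0 ltW.
- by rewrite nnegrE mulr_ge0// ltW.
- move: n2; rewrite exprS => n2.
  have -> : 2 / T * (d - c) = 2 * (d - c) / T by ring.
  rewrite ler_pdivlMr//.
  have -> : 2 ^- n * T = 2 * (T / (2 * 2 ^+ n)) by field; rewrite gt_eqF.
  by rewrite ltW// ltr_pM2l.
Unshelve. all: by end_near. Qed.

End Dyadic.

(** * Almost sure Hoelder regularity *)

Section Kolmogorov.
Context (R : realType) (d : measure_display) (Omega : measurableType d).
Variables (P : probability Omega R) (H beta T : R) (B : R -> Omega -> R).
Hypotheses (hB : fBm P H B) (beta0 : 0 < beta) (betaH : beta < H) (T0 : 0 < T).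

Let pt := dyadic_point T.
Let X n k w := B (pt n k.+1) w - B (pt n k) w.
Let sg n := (T / 2 ^+ n) `^ H.
(** The coefficient of [normal_exp_sqr] at [r = 2]: every [expR (c n * X n k w ^+ 2)] has
    expectation 2. *)
Let c n := (1 - 2 ^- 2) / (2 * sg n ^+ 2).

Let sg0 n : 0 < sg n. Proof. by rewrite powR_gt0// divr_gt0// exprn_gt0. Qed.

Let X_law n k : has_law P (X n k) (normal_law 0 (sg n)).
Proof.
have := fBm_increment_law hB (dyadic_point_ge0 T0 n k) (dyadic_point_ge0 T0 n k.+1)
  (lt_trans beta0 betaH).
rewrite dyadic_pointB -natr1 addrAC subrr add0r mulr1.
by rewrite gtr0_norm// divr_gt0// exprn_gt0.
Qed.

(* The weighted sum of the [f n] has finite expectation; where it is finite, it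
   bounds all dyadic increments at once, as [expR] dominates every power. *)
Let f n w : \bar R := (4 ^- n * \sum_(k < 2 ^ n) expR (c n * X n k w ^+ 2))%:E.

Let f_ge0 n w : (0 <= f n w)%E.
Proof. by rewrite lee_fin mulr_ge0 ?invr_ge0 ?exprn_ge0// sumr_ge0// => k _; exact: expR_ge0. Qed.

Let f_meas n : measurable_fun setT (f n).
Proof.
apply/measurable_EFinP; apply: measurable_funM => //; apply: measurable_sum => k.
apply: measurableT_comp => //; apply: measurable_funM => //; apply: measurable_funX.
by have [] := X_law n k.
Qed.

(** The [2 ^ n] terms of expectation 2, weighted by [4 ^- n], give [2 / 2 ^ n], written in the
    summable form of [epsilon_trick0]. *)
Let integral_f n : (\int[P]_w f n w = (4 / (2 ^ n.+1)%:R)%:E)%E.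
Proof.
have e k : (\int[P]_w (expR (c n * X n k w ^+ 2))%:E = 2%:E)%E.
  by apply: (normal_exp_sqr (X_law n k)) => //; rewrite gt_eqF.
have m k : measurable_fun setT (fun w => (expR (c n * X n k w ^+ 2))%:E).
  apply/measurable_EFinP; apply: measurableT_comp => //; apply: measurable_funM => //.
  by apply: measurable_funX; have [] := X_law n k.
rewrite /f; under eq_integral do rewrite EFinM -sumEFin.
rewrite ge0_integralZl//.
- rewrite ge0_integral_sum//.
  under eq_bigr do rewrite e.
  rewrite sumEFin sumr_const card_ord -EFinM; congr EFin.
  rewrite -[2 *+ _]mulr_natl natrX natrX exprS.
  have -> : 4 ^- n = (2 ^+ n * 2 ^+ n)^-1 :> R by rewrite -exprMn; congr (_ ^- _); ring.
  by field; rewrite expf_neq0.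
- by apply: emeasurable_sum.
- by move=> w _; rewrite sume_ge0// => k _; rewrite lee_fin expR_ge0.
Qed.

Lemma fBm_holder_finite :
  {ae P, forall w, (holder_seminorm Num.norm beta T (fun t => B t w) < +oo)%E}.
Proof.
have I : P.-integrable setT (fun w => \sum_(0 <= n <oo) f n w)%E.
  apply/integrableP; split.
    apply: ge0_emeasurable_sum => //.
  under eq_integral do rewrite gee0_abs ?nneseries_ge0//.
  rewrite integral_nneseries//.
  rewrite (eq_eseriesr (g := fun n => (4 / (2 ^ n.+1)%:R)%:E)); last by move=> n _; exact: integral_f.
  exact: le_lt_trans (epsilon_trick0 _ _) (ltry 4).
apply: filterS (integrable_ae measurableT I) => w /(_ Logic.I).
set S := (\sum_(0 <= n <oo) f n w)%E => Sfin.
set s := fine S.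
have fS n : (f n w <= s%:E)%E.
  rewrite fineK// /S (@nneseriesD1 _ _ n)//; apply: leeDl.
  by apply: nneseries_ge0 => k _ _; exact: f_ge0.
have s0 : 0 <= s by rewrite -lee_fin; exact: le_trans (f_ge0 0%N w) (fS 0%N).
have eps0 : 0 < H - beta by rewrite subr_gt0.
set e := H - beta in eps0.
(* The factor [8 / 3] comes from [(c n)^-1 = 8 / 3 * sg n ^+ 2], and [e^-1] from bounding [e * y] by
   [expR (e * y)]. *)
pose C := 8 / (3 * e) * (T `^ H) ^+ 2 * s `^ e.
have C0 : 0 <= C.
  by rewrite !mulr_ge0 ?powR_ge0 ?sqr_ge0// invr_ge0 mulr_ge0// ltW.
apply: (@holder_chaining R T T0 _ beta (Num.sqrt C)) => //.
  by have [_ _ _] := hB; exact.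
move=> n k kn; rewrite -/pt -[X in `|X|]/(X n k w).
set b := 2 ^+ n : R; have b0 : 0 < b by rewrite exprn_gt0.
have -> : (2 `^ (- beta)) ^+ n = b `^ (- beta).
  by rewrite -powR_mulrn ?powR_ge0// -powRrM mulrC powRrM powR_mulrn.
rewrite -ler_sqr ?nnegrE ?mulr_ge0 ?sqrtr_ge0 ?powR_ge0// real_normK ?num_real//.
rewrite exprMn sqr_sqrtr//.
have sgE : sg n = T `^ H * b `^ (- H).
  by rewrite /sg powRM ?invr_ge0 ?ltW// powRN -/b -powR_inv1 ?ltW// -powRrM mulN1r powRN.
have u1 : expR (c n * X n k w ^+ 2) <= b * b * s.
  have := fS n; rewrite lee_fin mulrC ler_pdivrMr ?exprn_gt0// => h.
  have -> : b * b * s = s * 4 ^+ n by rewrite /b -exprMn mulrC; congr (_ * _ ^+ _); ring.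
  apply: le_trans h; rewrite (bigD1 (Ordinal kn))//= lerDl.
  by apply: sumr_ge0 => i _; exact: expR_ge0.
(* Raising the bound [4 ^+ n * s] to the power [e = H - beta] costs [b^(2 * e)], which is exactly
   what turns the factor [b^(- 2 * H)] of [sg n ^+ 2] into [b^(- 2 * beta)]. *)
have u2 : e * (c n * X n k w ^+ 2) <= b `^ e * b `^ e * s `^ e.
  have h := expR_ge1Dx (e * (c n * X n k w ^+ 2)).
  apply: (@le_trans _ _ (expR (e * (c n * X n k w ^+ 2)))); first by lra.
  rewrite mulrC expRM -!powRM ?mulr_ge0 ?(ltW b0)//.
  by apply: ge0_ler_powR => //; rewrite ?nnegrE ?expR_ge0 ?mulr_ge0 ?(ltW b0) ?(ltW eps0).
have Y : X n k w ^+ 2 <= 8 / (3 * e) * sg n ^+ 2 * (b `^ e * b `^ e * s `^ e).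
  have q0 : 0 < 8 / (3 * e) * sg n ^+ 2.
    by rewrite mulr_gt0 ?exprn_gt0// divr_gt0// mulr_gt0.
  rewrite -ler_pdivrMl//; apply: le_trans u2.
  by rewrite le_eqVlt; apply/orP; left; apply/eqP; rewrite /c; field; rewrite !gt_eqF.
apply: (le_trans Y); rewrite /C sgE.
have -> : b `^ (- beta) = b `^ (- H) * b `^ e.
  by rewrite -powRD; [congr (_ `^ _); rewrite /e; ring|rewrite (gt_eqF b0)/= implybT].
by rewrite le_eqVlt; apply/orP; left; apply/eqP; ring.
Qed.

End Kolmogorov.

(** * Measurability and distribution function of the seminorm *)

Section HolderMeasurable.
Context (R : realType) (d : measure_display) (Omega : measurableType d).
Variables (P : probability Omega R) (H beta T : R) (B : R -> Omega -> R).
Hypotheses (hB : fBm P H B) (beta0 : 0 < beta) (T0 : 0 < T).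

Let pt := dyadic_point T.
Let h w := holder_seminorm Num.norm beta T (fun t => B t w).

Let cont w : {within `[0, +oo[, continuous (fun t => B t w)}.
Proof. by have [_ _ _] := hB; exact. Qed.

Lemma dyadic_ratio_le (f : R -> R) n i j : (i < j <= 2 ^ n)%N ->
  ((`|f (pt n j) - f (pt n i)| / (pt n j - pt n i) `^ beta)%:E <=
    holder_seminorm Num.norm beta T f)%E.
Proof.
move=> /andP[ij jn]; apply: ereal_sup_ubound; exists (pt n i), (pt n j).
have lt : pt n i < pt n j.
  rewrite /pt /dyadic_point ltr_pM2r ?invr_gt0 ?exprn_gt0// ltr_pM2l// ltr_nat//.
split=> //.
- exact: dyadic_point_ge0.
- exact: dyadic_point_le.
- have -> // : `|pt n j - pt n i| = pt n j - pt n i.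
  by rewrite gtr0_norm// subr_gt0.
Qed.

Lemma holder_seminorm_ge0 (f : R -> R) : (0 <= holder_seminorm Num.norm beta T f)%E.
Proof.
apply: (le_trans _ (@dyadic_ratio_le f 0%N 0%N 1%N isT)).
by rewrite lee_fin divr_ge0// powR_ge0.
Qed.

Lemma measurable_holder_seminorm : measurable_fun setT h.
Proof.
(* Codes of no admissible pair receive 0, which leaves the supremum unchanged because the seminorm
   is nonnegative. *)
pose r (k : nat) (w : Omega) : \bar R :=
  if (choice.unpickle k : option (nat * nat * nat)) is Some (n, i, j) then
    if (i < j <= 2 ^ n)%N then
      (`|B (pt n j) w - B (pt n i) w| / (pt n j - pt n i) `^ beta)%:E else 0%E
  else 0%E.
have -> : h = fun w => esups (r ^~ w) 0%N.
  apply/funext => w; apply/eqP; rewrite eq_le; apply/andP; split.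
    apply: holder_dyadic_le => // n i j ijn; rewrite /esups.
    apply: ereal_sup_ubound; exists (choice.pickle (n, i, j)) => //=.
    by rewrite /r choice.pickleK ijn.
  rewrite /esups; apply/ereal_supP => _ [k _ <-]; rewrite /r.
  case: choice.unpickle => [[[n i] j]|]; last exact: holder_seminorm_ge0.
  case: ifPn => ijn; last exact: holder_seminorm_ge0.
  exact: dyadic_ratio_le.
apply: measurable_fun_esups => k.
suff : measurable_fun setT (r k) by [].
rewrite /r.
case: (choice.unpickle k : option (nat * nat * nat)) => [[[n i] j]|]; last exact: measurable_cst.
case: (i < j <= 2 ^ n)%N; last exact: measurable_cst.
apply/measurable_EFinP; apply: measurable_funM => //; apply: measurableT_comp => //.
by apply: measurable_funB; apply: (fBm_measurable hB); exact: dyadic_point_ge0.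
Qed.

(* One-sided inequalities suffice, since [ij] ranges over all ordered pairs. *)
Definition dyadic_holder_set (n : nat) (z : R) : set Omega :=
  [set w | forall ij : 'I_(2 ^ n).+1 * 'I_(2 ^ n).+1,
    B (pt n ij.2) w - B (pt n ij.1) w <= z * `|pt n ij.2 - pt n ij.1| `^ beta].

Lemma holder_sublevel_set z : 0 <= z ->
  [set w | (h w <= z%:E)%E] = \bigcap_n dyadic_holder_set n z.
Proof.
move=> z0; apply/seteqP; split => [w /= hz n _ [i j] /=|w /= Hw].
  have le_pt (a b : nat) : (a <= 2 ^ n)%N -> (b <= 2 ^ n)%N -> (a < b)%N ->
      `|B (pt n b) w - B (pt n a) w| <= z * `|pt n b - pt n a| `^ beta.
    move=> an bn ab.
    have lt : pt n a < pt n b.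
      by rewrite /pt /dyadic_point ltr_pM2r ?invr_gt0 ?exprn_gt0// ltr_pM2l// ltr_nat.
    have abn : (a < b <= 2 ^ n)%N by rewrite ab.
    have := le_trans (dyadic_ratio_le (fun t => B t w) abn) hz.
    have -> : `|pt n b - pt n a| = pt n b - pt n a by rewrite gtr0_norm// subr_gt0.
    by rewrite lee_fin ler_pdivrMr ?powR_gt0 ?subr_gt0.
  have hi := ltn_ord i; have hj := ltn_ord j; rewrite !ltnS in hi hj.
  have [ij|ij|->] := ltngtP (i : nat) j.
  - exact: le_trans (ler_norm _) (le_pt _ _ hi hj ij).
  - by rewrite distrC; apply: le_trans (le_pt _ _ hj hi ij); rewrite -normrN opprB ler_norm.
  - by rewrite !subrr normr0 mulr_ge0// powR_ge0.
apply: holder_dyadic_le => // n i j /andP[ij jn].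
have lt : pt n i < pt n j.
  by rewrite /pt /dyadic_point ltr_pM2r ?invr_gt0 ?exprn_gt0// ltr_pM2l// ltr_nat.
rewrite -/pt lee_fin ler_pdivrMr ?powR_gt0 ?subr_gt0//.
have i' : (i < (2 ^ n).+1)%N by rewrite ltnS (leq_trans (ltnW ij)).
have j' : (j < (2 ^ n).+1)%N by rewrite ltnS.
have := Hw n I (Ordinal i', Ordinal j'); have := Hw n I (Ordinal j', Ordinal i') => /=.
rewrite (distrC (pt n i)) (gtr0_norm (_ : 0 < pt n j - pt n i)) ?subr_gt0// => h1 h2.
by rewrite ler_norml h2 andbT lerNl opprB.
Qed.

(** Doubling the indices embeds the points of one level into those of the next; continuity of the
    measure from above then applies. *)
Lemma dyadic_holder_set_mono z : {homo dyadic_holder_set^~ z : n m / (n <= m)%N >-> (m <= n)%O}.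
Proof.
apply: homo_leq => [A|A B' C BA CB|n]; first exact: lexx.
  exact: le_trans CB BA.
apply/subsetPset => w /= Hw [i j] /=.
have di (k : 'I_(2 ^ n).+1) : (k.*2 < (2 ^ n.+1).+1)%N.
  by rewrite ltnS expnS mul2n leq_double -ltnS ltn_ord.
have := Hw (Ordinal (di i), Ordinal (di j)).
by rewrite /= /pt !dyadic_point_double.
Qed.

Lemma measurable_dyadic_holder_set n z : measurable (dyadic_holder_set n z).
Proof.
rewrite /dyadic_holder_set.
rewrite (_ : mkset _ = \bigcap_(ij in [set: 'I_(2 ^ n).+1 * 'I_(2 ^ n).+1])
  ((fun w => B (pt n ij.2) w - B (pt n ij.1) w) @^-1`
    [set x | x <= z * `|pt n ij.2 - pt n ij.1| `^ beta])).
  apply: fin_bigcap_measurable; first exact: finite_finset.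
  move=> ij _; rewrite -[X in measurable X]setTI.
  suff m : measurable_fun setT (fun w => B (pt n ij.2) w - B (pt n ij.1) w).
    by apply: m => //; rewrite -set_itvNyc.
  by apply: measurable_funB; apply: (fBm_measurable hB); exact: dyadic_point_ge0.
by apply/seteqP; split => [w Hw i _|w Hw i]; [exact: Hw|exact: (Hw i)].
Qed.

Lemma holder_cdf_cvg z : 0 <= z ->
  (fun n => P (dyadic_holder_set n z)) @ \oo --> P [set w | (h w <= z%:E)%E].
Proof.
move=> z0; rewrite holder_sublevel_set//.
apply: nonincreasing_cvg_mu.
- exact: le_lt_trans (probability_le1 _ (measurable_dyadic_holder_set _ _)) (ltry _).
- by move=> n; exact: measurable_dyadic_holder_set.
- by apply: bigcap_measurable => // n _; exact: measurable_dyadic_holder_set.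
- exact: dyadic_holder_set_mono.
Qed.

End HolderMeasurable.

(** * The law of the Hoelder seminorm *)

Section EqualLaw.
Context (R : realType) (d d' : measure_display).
Context (Omega : measurableType d) (Omega' : measurableType d').
Variables (P : probability Omega R) (P' : probability Omega' R).

(** Adding 1 to the cosine gives a nonnegative function, as [has_normal_law_integral] requires. *)
Lemma normal_integral_cos_eq (Z : Omega -> R) (Z' : Omega' -> R) s b :
  has_law P Z (normal_law 0 s) -> has_law P' Z' (normal_law 0 s) ->
  (\int[P]_w (cos (Z w + b))%:E = \int[P']_w (cos (Z' w + b))%:E)%E.
Proof.
move=> hZ hZ'.
have mc : measurable_fun setT (fun x : R => 1 + cos (x + b)).
  apply: measurable_funD => //.
  by have [] := bounded_measurable_cos b (@measurable_id _ R setT).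
have c0 (x : R) : 0 <= 1 + cos (x + b) by have := cos_geN1 (x + b); lra.
have E : (\int[P]_w (1 + cos (Z w + b))%:E = \int[P']_w (1 + cos (Z' w + b))%:E)%E.
  by rewrite (has_normal_law_integral hZ mc c0) (has_normal_law_integral hZ' mc c0).
have S d0 (O : measurableType d0) (Q : probability O R) (Y : O -> R) :
    measurable_fun setT Y ->
    (\int[Q]_w (cos (Y w + b))%:E = \int[Q]_w (1 + cos (Y w + b))%:E + (-1)%:E)%E.
  move=> mY; have bc := bounded_measurable_cst O (-1 : R).
  have bD := bounded_measurableD (bounded_measurable_cst O (1 : R)) (bounded_measurable_cos b mY).
  transitivity (\int[Q]_w ((1 + cos (Y w + b))%:E + (-1)%:E))%E.
    by apply: eq_integral => w _; rewrite -EFinD; congr EFin; ring.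
  rewrite integralD//.
  - by rewrite integral_cst// [X in (_ * X)%E]probability_setT mule1.
  - exact: (bounded_measurable_integrable Q bD).
  - exact: (bounded_measurable_integrable Q bc).
rewrite S; last by case: hZ.
by rewrite E [RHS]S//; case: hZ'.
Qed.

Variables (H beta T : R) (B : R -> Omega -> R) (B' : R -> Omega' -> R).
Hypotheses (hB : fBm P H B) (hB' : fBm P' H B').
Hypotheses (beta0 : 0 < beta) (betaH : beta < H) (T0 : 0 < T).

Let h w := holder_seminorm Num.norm beta T (fun t => B t w).
Let h' w := holder_seminorm Num.norm beta T (fun t => B' t w).

Definition fBm_combination (Z : Omega -> R) (Z' : Omega' -> R) : Prop :=
  exists (k : nat) (t a : 'I_k -> R), [/\ forall i, 0 <= t i,
    Z = (fun w => \sum_(i < k) a i * B (t i) w) &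
    Z' = (fun w => \sum_(i < k) a i * B' (t i) w)].

Lemma fBm_combination_lin Z1 Z1' Z2 Z2' (a b : R) :
  fBm_combination Z1 Z1' -> fBm_combination Z2 Z2' ->
  fBm_combination (fun w => a * Z1 w + b * Z2 w) (fun w => a * Z1' w + b * Z2' w).
Proof.
move=> [k1 [t1 [a1 [t10 -> ->]]]] [k2 [t2 [a2 [t20 -> ->]]]].
exists (k1 + k2)%N.
exists (fun i => match fintype.split i with inl i1 => t1 i1 | inr i2 => t2 i2 end).
exists (fun i => match fintype.split i with inl i1 => a * a1 i1 | inr i2 => b * a2 i2 end).
have sl (i : 'I_k1) : fintype.split (lshift k2 i) = inl i by exact: (unsplitK (inl i)).
have sr (i : 'I_k2) : fintype.split (rshift k1 i) = inr i by exact: (unsplitK (inr i)).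
split.
- by move=> i; case: fintype.split.
- apply/funext => w; rewrite big_split_ord/= !mulr_sumr.
  by congr (_ + _); apply: eq_bigr => i _; rewrite ?sl ?sr mulrA.
- apply/funext => w; rewrite big_split_ord/= !mulr_sumr.
  by congr (_ + _); apply: eq_bigr => i _; rewrite ?sl ?sr mulrA.
Qed.

Lemma fBm_combination_increment s t : 0 <= s -> 0 <= t ->
  fBm_combination (fun w => B t w - B s w) (fun w => B' t w - B' s w).
Proof.
move=> s0 t0; exists 2%N, (fun i => if i == ord0 then t else s).
exists (fun i => if i == ord0 then 1 else -1); split.
- by move=> i; case: ifP.
- by apply/funext => w; rewrite big_ord_recl big_ord1/= mul1r mulN1r.
- by apply/funext => w; rewrite big_ord_recl big_ord1/= mul1r mulN1r.
Qed.

Lemma dyadic_holder_set_prob n z :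
  P (dyadic_holder_set beta T B n z) = P' (dyadic_holder_set beta T B' n z).
Proof.
set K := ('I_(2 ^ n).+1 * 'I_(2 ^ n).+1)%type.
pose Z (i : 'I_#|{: K}|) w := let ij : K := enum_val i in
  B (dyadic_point T n ij.2) w - B (dyadic_point T n ij.1) w.
pose Z' (i : 'I_#|{: K}|) w := let ij : K := enum_val i in
  B' (dyadic_point T n ij.2) w - B' (dyadic_point T n ij.1) w.
pose z_ (i : 'I_#|{: K}|) := let ij : K := enum_val i in
  z * `|dyadic_point T n ij.2 - dyadic_point T n ij.1| `^ beta.
have -> : dyadic_holder_set beta T B n z = [set w | forall i, Z i w <= z_ i].
  apply/seteqP; split => w Hw; first by move=> i; exact: Hw.
  by move=> ij; have := Hw (enum_rank ij); rewrite /Z /z_ enum_rankK.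
have -> : dyadic_holder_set beta T B' n z = [set w | forall i, Z' i w <= z_ i].
  apply/seteqP; split => w Hw; first by move=> i; exact: Hw.
  by move=> ij; have := Hw (enum_rank ij); rewrite /Z' /z_ enum_rankK.
apply: (joint_cdf_eq fBm_combination_lin).
- move=> _ _ [k [t [a [t0 -> ->]]]]; split.
    by have [] := fBm_combination_law hB a t0.
  by have [] := fBm_combination_law hB' a t0.
- move=> _ _ b [k [t [a [t0 -> ->]]]].
  apply: normal_integral_cos_eq; [exact: (fBm_combination_law hB a t0)|].
  exact: (fBm_combination_law hB' a t0).
- by exists (fun w => B 0 w - B 0 w), (fun w => B' 0 w - B' 0 w); exact: fBm_combination_increment.
- by move=> i; apply: fBm_combination_increment; exact: dyadic_point_ge0.
Qed.

Lemma holder_cdf_eq z : 0 <= z ->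
  P [set w | (h w <= z%:E)%E] = P' [set w | (h' w <= z%:E)%E].
Proof.
move=> z0; have C1 := holder_cdf_cvg hB beta0 T0 z0.
have C2 := holder_cdf_cvg hB' beta0 T0 z0.
rewrite (_ : (fun n => _) = (fun n => P' (dyadic_holder_set beta T B' n z))) in C1.
  exact: cvg_unique C1 C2.
by apply/funext => n; exact: dyadic_holder_set_prob.
Qed.

End EqualLaw.

Section Expectation.
Context (R : realType) (d d' : measure_display).
Context (Omega : measurableType d) (Omega' : measurableType d').
Variables (P : probability Omega R) (P' : probability Omega' R).
Variables (H beta T : R) (B : R -> Omega -> R) (B' : R -> Omega' -> R).
Hypotheses (hB : fBm P H B) (hB' : fBm P' H B').
Hypotheses (beta0 : 0 < beta) (betaH : beta < H) (T0 : 0 < T).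

Lemma measurable_fine_holder d0 (O : measurableType d0) (Q : probability O R)
    (X : R -> O -> R) : fBm Q H X ->
  measurable_fun setT (fun w => fine (holder_seminorm Num.norm beta T (fun t => X t w))).
Proof.
move=> hX; apply: (measurableT_comp (f := fine)) => //.
exact: (measurable_holder_seminorm hX).
Qed.

(** Comparison of tails. As [fine] sends +oo to 0, it can only lower the tail on the left; on the
    right the discrepancy lies in the set where the seminorm is infinite, null by
    [fBm_holder_finite]. *)
Lemma expectation_fine_holder_le :
  (\int[P]_w (fine (holder_seminorm Num.norm beta T (fun t => B t w)))%:E <=
   \int[P']_w (holder_seminorm Num.norm beta T (fun t => B' t w)))%E.
Proof.
set h := fun w => holder_seminorm Num.norm beta T (fun t => B t w).
set h' := fun w => holder_seminorm Num.norm beta T (fun t => B' t w).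
have h0 w : (0 <= h w)%E by exact: holder_seminorm_ge0.
have h0' w : (0 <= h' w)%E by exact: holder_seminorm_ge0.
have mh := measurable_holder_seminorm hB beta0 T0.
have mh' := measurable_holder_seminorm hB' beta0 T0.
pose X : {RV P >-> R} := HB.pack (fun w => fine (h w))
  (isMeasurableFun.Build _ _ _ _ (fun w => fine (h w)) (measurable_fine_holder hB)).
pose X' : {RV P' >-> R} := HB.pack (fun w => fine (h' w))
  (isMeasurableFun.Build _ _ _ _ (fun w => fine (h' w)) (measurable_fine_holder hB')).
have X0 w : 0 <= X w by exact: fine_ge0.
have X0' w : 0 <= X' w by exact: fine_ge0.
apply: (@le_trans _ _ (\int[P']_w (X' w)%:E)%E); last first.
  apply: ge0_le_integral => //.
  - by move=> w _; rewrite lee_fin.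
  - by apply/measurable_EFinP; exact: (measurable_fine_holder hB').
  - by move=> w _; have := h0' w; rewrite /= -/(h' w); case: (h' w) => [r _|_|] //=; rewrite ?lexx ?leey.
have -> : (\int[P]_w (fine (h w))%:E = 'E_P[X])%E by rewrite unlock.
have -> : (\int[P']_w (X' w)%:E = 'E_P'[X'])%E by rewrite unlock.
rewrite !ge0_expectation_ccdf//.
have mlt d0 (O : measurableType d0) (g : O -> \bar R) r :
    measurable_fun setT g -> measurable [set w | (g w <= r%:E)%E].
  by move=> mg; rewrite -[X in measurable X]setTI; exact: emeasurable_fun_infty_c.
apply: ge0_le_integral => //.
- by apply: measurable_funTS; exact: ccdf_measurable.
- by apply: measurable_funTS; exact: ccdf_measurable.
move=> r; rewrite /= in_itv/= andbT => r0.
have mo : measurable [set w | (h' w = +oo)%E].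
  have := mh' measurableT _ (emeasurable_set1 +oo%E).
  by rewrite setTI.
have inf0 : P' [set w | (h' w = +oo)%E] = 0%E.
  apply/(negligibleP _ mo).
  have [N [mN N0 sN]] := fBm_holder_finite hB' beta0 betaH T0.
  exists N; split => //; apply: subset_trans sN => w /= e.
  by rewrite -/(h' w) e ltxx.
have mX d0 (O : measurableType d0) (Q : probability O R) (Y : {RV Q >-> R}) :
    measurable [set w | r < Y w].
  rewrite (_ : mkset _ = Y @^-1` `]r, +oo[); first exact: measurable_funPTI.
  by apply/seteqP; split => w /=; rewrite in_itv/= andbT.
have eX d0 (O : measurableType d0) (Q : probability O R) (Y : {RV Q >-> R}) :
    ccdf Y r = Q [set w | r < Y w].
  rewrite /ccdf /distribution /pushforward; congr (Q _).
  by apply/seteqP; split => w /=; rewrite in_itv/= andbT.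
rewrite !eX.
have C d0 (O : measurableType d0) (Q : probability O R) (g : O -> \bar R) :
    measurable_fun setT g -> Q [set w | (r%:E < g w)%E] = (1 - Q [set w | (g w <= r%:E)%E])%E.
  move=> mg; rewrite -probability_setC; last exact: mlt.
  congr (Q _); apply/seteqP; split => w /=; first by move=> lt; apply/negP; rewrite -ltNge.
  by move/negP; rewrite -ltNge.
apply: (@le_trans _ _ (P [set w | (r%:E < h w)%E])).
  apply: le_measure; rewrite ?inE; first exact: mX.
    by rewrite -[X in measurable X]setTI; exact: emeasurable_fun_o_infty.
  move=> w /=; have := h0 w; case: (h w) => [x| |]//= _.
  by rewrite ltNge r0.
rewrite C// (holder_cdf_eq hB hB' beta0 T0 r0) -C//.
rewrite -[leRHS]adde0 -inf0.
apply: (@le_trans _ _ (P' ([set w | r < X' w] `|` [set w | (h' w = +oo)%E]))); last first.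
  exact: measureU2 (mX _ _ _ _) mo.
apply: le_measure; rewrite ?inE.
- by rewrite -[X in measurable X]setTI; exact: emeasurable_fun_o_infty.
- apply: measurableU; first exact: mX.
  exact: mo.
move=> w /=; rewrite -/(h' w); have := h0' w; case E : (h' w) => [x| |]//= _ lt; last by right.
by suff : r < fine (h' w) by [left]; rewrite E.
Qed.

End Expectation.

(** * Bounds for regular fields, and the theorem *)

Section Fields.
Variables (R : realType) (n : nat) (U : nat -> 'rV[R]_n -> 'rV[R]_n).
Variables (Mc M1 M2 : nat -> R).
Hypotheses (n0 : (0 < n)%N) (hU : regular_fields U Mc M1 M2).

(** Each constant dominates an absolute value, up to a positive norm, once there is a coordinate and
    a nonzero vector. *)
Lemma regular_fields_ge0 k : [/\ 0 <= Mc k, 0 <= M1 k & 0 <= M2 k].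
Proof.
have [_ hM hM1 hM2 _] := hU; pose i : 'I_n := Ordinal n0.
have N : 0 < norm2 (const_mx 1 - 0 : 'rV[R]_n).
  apply: lt_le_trans (ler_norm_norm2 _); rewrite subr0.
  by apply: lt_le_trans (ler_coord_norm _ i); rewrite mxE normr1.
split.
- exact: le_trans (normr_ge0 _) (hM k 0 i).
- by rewrite -(pmulr_lge0 _ N); exact: le_trans (normr_ge0 _) (hM1 k _ _ i).
- by rewrite -(pmulr_lge0 _ N); exact: le_trans (normr_ge0 _) (hM2 k _ _ i i).
Qed.

(** One constant for the size, the increments and the second differences of the fields, the last of
    which require [n ^ 2]. A sum over [I] depends only on the multiset of triples, which is all that
    [K] receives. *)
Definition field_bound (I : {fset nat}) : R :=
  n%:R ^+ 2 * \sum_(k <- I) (Mc k + M1 k + M2 k).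

Lemma field_bound_ge0 I : 0 <= field_bound I.
Proof.
rewrite mulr_ge0 ?exprn_ge0// sumr_ge0// => k _.
by have [? ? ?] := regular_fields_ge0 k; rewrite !addr_ge0.
Qed.

Lemma le_field_bound I k : k \in I -> n%:R ^+ 2 * (Mc k + M1 k + M2 k) <= field_bound I.
Proof.
move=> kI; rewrite ler_wpM2l ?exprn_ge0// (big_rem k)//= lerDl sumr_ge0// => j _.
by have [? ? ?] := regular_fields_ge0 j; rewrite !addr_ge0.
Qed.

Lemma regular_fields_bounds I k : k \in I ->
  [/\ forall x i, `|U k x ord0 i| <= field_bound I,
      forall x y i, `|U k x ord0 i - U k y ord0 i| <= field_bound I * `|x - y| &
      forall p q v i,
        `|(U k (p + v) ord0 i - U k p ord0 i) - (U k (q + v) ord0 i - U k q ord0 i)| <=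
        field_bound I * `|v| * `|p - q|].
Proof.
move=> kI; have [dU hM hM1 hM2 _] := hU; have [Mc0 M10 M20] := regular_fields_ge0 k.
have n1 : 1 <= n%:R :> R by rewrite ler1n.
have nn : n%:R <= n%:R ^+ 2 :> R by rewrite expr2 ler_peMr.
have le_b (a b : R) : 0 <= a -> a <= Mc k + M1 k + M2 k -> 0 <= b -> b <= n%:R ^+ 2 ->
    b * a <= field_bound I.
  by move=> a0 ak b0 bn; apply: le_trans (le_field_bound kI); exact: ler_pM.
split.
- move=> x i; apply: (le_trans (hM k x i)); rewrite -[leLHS]mul1r.
  by apply: le_b => //; [lra|exact: le_trans nn].
- move=> x y i; apply: (le_trans (hM1 k x y i)).
  apply: (@le_trans _ _ (M1 k * (n%:R * `|x - y|))).
    by rewrite ler_wpM2l// ler_norm2_norm.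
  by rewrite mulrA ler_wpM2r// mulrC le_b//; lra.
- move=> p q v i; apply: (le_trans (second_difference_le (dU k) p q v M20 _)).
    by move=> x y j; exact: hM2.
  by rewrite ler_wpM2r// ler_wpM2r// le_b ?exprn_ge0//; lra.
Qed.

End Fields.

Lemma sume_le_size (R : realType) (T : Type) (s : seq T) (a : T -> \bar R) (x : \bar R) :
  (0 <= x)%E -> (forall k, (a k <= x)%E) ->
  (\sum_(k <- s) a k <= (size s)%:R%:E * x)%E.
Proof.
move=> x0 ax; elim: s => [|k s IH]; first by rewrite big_nil mul0e.
rewrite big_cons /= -natr1 addrC EFinD ge0_muleDl ?lee_fin// mul1e.
exact: leeD.
Qed.

(* [F] and [K] are chosen before everything else: their arguments are exactly
   the quantities on which C_{1,T} and C_1 are allowed to depend. *)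
Theorem theorem3p5 (R : realType) :
  exists (F : R -> R -> nat -> forall I : {fset nat},
            (I -> \bar R) -> (I -> R) -> (I -> R) -> (I -> R) -> R)
         (K : R -> R -> nat -> nat -> {mset (R * R * R)%type}%mset -> R),
  forall (H : R) (hH : 2^-1 < H < 1)
    (m n : nat) (hmn : (m < n)%N)
    (d : measure_display) (Omega : measurableType d)
    (P : probability Omega R)
    (B : nat -> R -> Omega -> R)
    (hB : forall gamma, fBm P H (B gamma))
    (hBindep : independent_processes P B)
    (U : nat -> 'rV[R]_n -> 'rV[R]_n) (Mc M1 M2 : nat -> R)
    (hU : regular_fields U Mc M1 M2)
    (I : {fset nat})
    (alpha beta delta eps : R)
    (halpha : alpha = 1 - H + delta) (hbeta : beta = H - eps)
    (heps : 0 < eps) (halpha_bnd : 1 - H < alpha < 2^-1)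
    (hdelta : eps < delta)
    (Phi : R -> 'rV[R]_n -> Omega -> 'rV[R]_n)
    (hPhi : {ae P, forall w, forall x : 'rV[R]_n,
       solves_flow_eq I U (fun gamma t => B gamma t w) (1 - alpha) x
         (fun t => Phi t x w)})
    (M : set 'rV[R]_n) (hM : embedded_C2_manifold m M),
  exists c1 : R, forall T : R, 0 < T ->
  exists C1T : {RV P >-> R},
    [/\ forall w, 0 <= C1T w,
        forall w, C1T w = F alpha beta n I
          (fun gamma => holder_seminorm Num.norm beta T
                          (fun t => B (\val gamma) t w))
          (fun gamma => Mc (\val gamma))
          (fun gamma => M1 (\val gamma))
          (fun gamma => M2 (\val gamma)),
        {ae P, forall w,
          (ereal_sup [set hausdorff m ((fun x => Phi t x w) @` M)
                     | t in `[0, T]]%R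
           <= c1%:E * hausdorff m M * (2 `^ (C1T w * T))%:E)%E} &
        forall (d' : measure_display) (Omega' : measurableType d')
          (P' : probability Omega' R) (BH : R -> Omega' -> R),
          fBm P' H BH ->
          ('E_P[fun w => (C1T w `^ beta)%R] <=
           (K alpha beta n #|` I|%fset
              (seq_mset [seq (Mc gamma, M1 gamma, M2 gamma) | gamma <- I]))%:E
           * \int[P']_w holder_seminorm Num.norm beta T
                          (fun t => BH t w))%E].
Proof.
(* The leading [n] stands in for the exponent [m] of the Lipschitz constant, as [m] is not an
   argument of [F]. Infinite seminorms, which occur with probability 0, are read as 0 by [fine]. *)
exists (fun alpha beta n (I : {fset nat}) (h : I -> \bar R) (Mc M1 M2 : I -> R) =>
  n%:R * (4 * (1 + 2 * young_const (1 - alpha + beta)) *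
    (n%:R ^+ 2 * \sum_(k : I) (Mc k + M1 k + M2 k)) *
    \sum_(k : I) fine (h k)) `^ beta^-1).
(* The power [beta] of [F], with the sum of seminorms replaced by the number [k] of its terms, each
   compared with the generic process. *)
exists (fun alpha beta n k s =>
  n%:R `^ beta * (4 * (1 + 2 * young_const (1 - alpha + beta)) *
    (n%:R ^+ 2 * \sum_(x <- s) (x.1.1 + x.1.2 + x.2))) * k%:R).
move=> H hH m n hmn d Omega P B hB _ U Mc M1 M2 hU I alpha beta delta eps halpha hbeta
  heps /andP[ha1 ha2] hdelta Phi hPhi M _.
have n0 : (0 < n)%N by exact: leq_ltn_trans hmn.
have lam0 : 0 < 1 - alpha by lra.
(* This is where [eps < delta] enters; with [alpha < 1 / 2] both exponents then exceed [1 / 2], as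
   Young integration demands. *)
have lam_beta : 1 - alpha <= beta by lra.
have th1 : 1 < 1 - alpha + beta by lra.
have beta0 : 0 < beta by lra.
have betaH : beta < H by lra.
have [_ K0] := young_const_eq th1.
set Kc := young_const _ in K0 *.
pose A := field_bound n Mc M1 M2 I.
have A0 : 0 <= A := field_bound_ge0 n0 hU I.
pose D := 4 * (1 + 2 * Kc) * A.
have D0 : 0 <= D by rewrite /D; apply: mulr_ge0 => //; lra.
(* The path-independent part of the Lipschitz constant in [flow_lipschitz], raised to the power
   [m]. *)
exists ((2 * n%:R) ^+ m) => T T0.
pose h k w := holder_seminorm Num.norm beta T (fun t => B k t w).
have h0 k w : (0 <= h k w)%E by exact: holder_seminorm_ge0.
pose S w := \sum_(k <- I) fine (h k w).
have S0 w : 0 <= S w by rewrite sumr_ge0// => k _; exact: fine_ge0.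
pose C w := (D * S w) `^ beta^-1.
have C0 w : 0 <= C w by exact: powR_ge0.
have mh k : measurable_fun setT (fun w => fine (h k w)) := measurable_fine_holder beta0 T0 (hB k).
have mC : measurable_fun setT (fun w => n%:R * C w).
  apply: measurable_funM => //; apply: (measurableT_comp (measurable_powR _)).
  by apply: measurable_funM => //; exact: measurable_sum.
pose C1T : {RV P >-> R} := HB.pack (fun w => n%:R * C w)
  (isMeasurableFun.Build _ _ _ _ (fun w => n%:R * C w) mC).
have C1TE w : C1T w = n%:R * C w by [].
exists C1T; split.
- by move=> w; rewrite C1TE mulr_ge0.
- move=> w; rewrite C1TE /C /D /A /field_bound /S.
  by rewrite !(big_seq_fsetE _ _ predT)/=.
(* One null set serves all [k]; outside it and that of [hPhi], the estimate is deterministic and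
   holds for all starting points at once. *)
- have hfin : {ae P, forall w, forall k, (h k w < +oo)%E}.
    by apply/ae_foralln => k; exact: (fBm_holder_finite (hB k) beta0 betaH T0).
  apply: filterS2 hPhi hfin => w hsol hw.
  apply/ereal_supP => _ [t /= + <-]; rewrite in_itv/= => tT.
  pose L : R := (2 * n%:R) * 2 `^ (C w * T).
  have L0 : 0 < L by rewrite !mulr_gt0 ?ltr0n// powR_gt0.
  have lip x y : norm2 (Phi t x w - Phi t y w) <= L * norm2 (x - y).
    have U1 k z i : k \in I -> `|U k z ord0 i| <= A.
      by move=> /(regular_fields_bounds n0 hU)[+ _ _]; exact.
    have U2 k z z' i : k \in I -> `|U k z ord0 i - U k z' ord0 i| <= A * `|z - z'|.
      by move=> /(regular_fields_bounds n0 hU)[_ + _]; exact.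
    have U3 k p q v i : k \in I ->
        `|(U k (p + v) ord0 i - U k p ord0 i) - (U k (q + v) ord0 i - U k q ord0 i)| <=
        A * `|v| * `|p - q|.
      by move=> /(regular_fields_bounds n0 hU)[_ _]; exact.
    have fh0 k : 0 <= fine (h k w) by exact: fine_ge0.
    have Bh k c c' : k \in I -> 0 <= c -> c <= c' -> c' <= T ->
        `|B k c' w - B k c w| <= fine (h k w) * (c' - c) `^ beta.
      move=> _ c0; rewrite le_eqVlt => /predU1P[<-|cc'] c'T.
        by rewrite subrr normr0 mulr_ge0 ?powR_ge0.
      exact: (holder_seminorm_le (hw k) c0 cc' c'T).
    exact: (flow_lipschitz lam0 lam_beta th1 A0 U1 U2 U3 fh0 Bh T0 (hsol x) (hsol y) tT).
  apply: (le_trans (hausdorff_image m M L0 lip)).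
  rewrite muleAC -EFinM; apply: lee_wpmul2r; first exact: hausdorff_ge0.
  rewrite lee_fin /L exprMn ler_wpM2l ?exprn_ge0 ?mulr_ge0//.
  (* Here [m] is replaced by the larger [n] in the exponent, which gives [C1T w * T]. *)
  rewrite -powR_mulrn ?powR_ge0// -powRrM ler_powR ?ler1n//.
  have -> : n%:R * C w * T = C w * T * n%:R by ring.
  by rewrite ler_wpM2l ?mulr_ge0 ?(ltW T0)// ler_nat ltnW.
- move=> d' Omega' P' BH hBH.
  rewrite (perm_big _ (perm_eq_seq_mset _)) big_map/=.
  have -> : n%:R ^+ 2 * (\sum_(k <- I) (Mc k + M1 k + M2 k)) = A by [].
  rewrite -/D unlock.
  have nD0 : 0 <= n%:R `^ beta * D by apply: mulr_ge0 => //; exact: powR_ge0.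
  have -> : (\int[P]_w (C1T w `^ beta)%:E =
      (n%:R `^ beta * D)%:E * \sum_(k <- I) \int[P]_w (fine (h k w))%:E)%E.
    have mS k : measurable_fun setT (fun w => (fine (h k w))%:E) by apply/measurable_EFinP.
    have fS k w : (0 <= (fine (h k w))%:E)%E by rewrite lee_fin fine_ge0.
    rewrite -ge0_integral_sum// -ge0_integralZl//.
    + apply: eq_integral => w _; have DS0 : 0 <= D * S w by exact: mulr_ge0.
      rewrite sumEFin -EFinM C1TE powRM// /C.
      by rewrite -powRrM mulVf ?gt_eqF// powRr1// mulrA.
    + exact: emeasurable_sum.
    + by move=> w _; rewrite sume_ge0.
  rewrite [in leRHS]EFinM -muleA; apply: lee_wpmul2l => //.
  apply: sume_le_size.
    by apply: integral_ge0 => w _; exact: holder_seminorm_ge0.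
  by move=> k; exact: (expectation_fine_holder_le (hB k) hBH beta0 betaH T0).
Qed.
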